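(* Let $k,m,n$ be positive integers, let $M$ be a compact $\mathcal{C}^\infty$-smooth $m$-dimensional manifold without boundary, and let $\ell$ be an integer with $0\leq \ell\leq k$. Suppose $\{f_1,\dots,f_n\}$ is an RD-basis of $\mathcal{C}^\ell(M)$. Then there is a $\mathcal{C}^\infty$-smooth function $g:M\rightarrow\mathbb{C}$ such that $\{f_1,\dots,f_n,g\}$ is a PD-basis of $\mathcal{C}^\ell(M)$.
   Context: $\mathcal{C}^\ell(M)$ is the space of $\ell$-times continuously differentiable $\mathbb{C}$-valued functions on $M$ (continuous functions if $\ell=0$), with the $\mathcal{C}^\ell$-norm $\|f\|=\sum_{\beta}\|f\circ\phi_\beta^{-1}\|_{\mathcal{C}^\ell(\phi_\beta(U_\beta))}$ associated to a finite atlas $\{(U_\beta,\phi_\beta)\}$ of $M$ (different choices give equivalent norms). Let $f_1,\dots,f_n\in\mathcal{C}^\infty(M)$ be complex-valued and $F=(f_1,\dots,f_n):M\to\mathbb{C}^n$. The set $\{f_1,\dots,f_n\}$ is an RD-basis of $\mathcal{C}^\ell(M)$ if $\{R\circ F : R \text{ is a rational function on } \mathbb{C}^n \text{ with no poles on } F(M)\}$ is dense in $\mathcal{C}^\ell(M)$ in the $\mathcal{C}^\ell$-norm. It is a PD-basis of $\mathcal{C}^\ell(M)$ if $\{P\circ F : P \text{ is a holomorphic polynomial on } \mathbb{C}^n\}$ is dense in $\mathcal{C}^\ell(M)$ in the $\mathcal{C}^\ell$-norm. *)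

(* Defs.v *)
From HB Require Import structures.
From mathcomp Require Import all_boot all_order all_algebra.
From mathcomp Require Import complex.
(* The notations of mpoly clash with those of MathComp-Analysis: [mpoly n R] is
   the ring of polynomials in n variables, [meval v p] the value of p at v, and
   [bmultinom n d] the finite type of multi-indices of length n and weight < d. *)
From mathcomp Require Import -(notations) mpoly.
From mathcomp Require Import all_classical all_reals all_analysis.

Set Implicit Arguments.
Unset Strict Implicit.
Unset Printing Implicit Defensive.

Import Order.TTheory GRing.Theory Num.Theory numFieldNormedType.Exports.

Local Open Scope classical_set_scope.
Local Open Scope ring_scope.
Local Open Scope complex_scope.

Section Calculus.
Variables (R : realType) (m : nat).
Implicit Types (W : set 'rV[R]_m) (u : 'rV[R]_m -> R) (h : 'rV[R]_m -> R[i]).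

Definition partial (i : 'I_m) u : 'rV[R]_m -> R :=
  fun x => 'D_(delta_mx 0 i) u x.

(* W is meant to be open; the values of u outside W are then irrelevant. *)
Fixpoint Cl_on (l : nat) W u : Prop :=
  if l is l'.+1 then
    {in W, continuous u} /\
    forall i : 'I_m, {in W, forall x, derivable u x (delta_mx 0 i)} /\
                     Cl_on l' W (partial i u)
  else {in W, continuous u}.

Definition smooth_on W u : Prop := forall l, Cl_on l W u.

Definition complex_Cl_on (l : nat) W h : Prop :=
  Cl_on l W (fun x => complex.Re (h x)) /\ Cl_on l W (fun x => complex.Im (h x)).

Definition partials (a : multinom m) u : 'rV[R]_m -> R :=
  foldr (fun i v => iter (a i) (partial i) v) u (enum 'I_m).

Definition complex_partials (a : multinom m) h : 'rV[R]_m -> R[i] :=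
  fun x => partials a (fun y => complex.Re (h y)) x +i*
           partials a (fun y => complex.Im (h y)) x.

(* The sum of sup_W |D^a h| over |a| <= l. The maximum with 0 only matters for
   W = set0, as ereal_sup set0 = -oo. *)
Definition Cl_norm_on (l : nat) W h : \bar R :=
  (\sum_(a : bmultinom m l.+1)
     maxe 0 (ereal_sup
       [set (Normc.normc (complex_partials a h x))%:E | x in W]))%E.

End Calculus.

Section Manifolds.
Variables (R : realType) (M : topologicalType) (m : nat).

Record chart := Chart {
  chart_dom : set M;
  chart_map :> M -> 'rV[R]_m;
  chart_inv : 'rV[R]_m -> M;
  open_chart_dom : open chart_dom;
  open_chart_img : open (chart_map @` chart_dom);
  chart_mapK : {in chart_dom, cancel chart_map chart_inv};
  continuous_chart_map : {in chart_dom, continuous chart_map};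
  continuous_chart_inv : {in chart_map @` chart_dom, continuous chart_inv}
}.

Definition chart_img (c : chart) : set 'rV[R]_m := c @` chart_dom c.

Definition smooth_transition (c d : chart) : Prop :=
  forall i : 'I_m,
    smooth_on (c @` (chart_dom c `&` chart_dom d))
              (fun y => d (chart_inv c y) 0 i).

(* A maximal smooth atlas. *)
Record smooth_structure := SmoothStructure {
  charts : set chart;
  charts_cover : forall x : M, exists2 c, charts c & chart_dom c x;
  charts_compatible : forall c d, charts c -> charts d -> smooth_transition c d;
  charts_maximal : forall c,
    (forall d, charts d -> smooth_transition c d /\ smooth_transition d c) ->
    charts c
}.

(* A finite atlas, each chart of which is the restriction of a chart whose
   domain contains the closure of the smaller domain. On a compact manifold
   such atlases exist, and the last condition makes the C^l-norm finite on
   C^l functions and independent of the atlas up to equivalence: for arbitrary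
   finite atlases, f \o phi^-1 may have unbounded derivatives. *)
Definition finite_atlas (S : smooth_structure) (r : nat) (B : 'I_r -> chart) :=
  [/\ forall b, charts S (B b),
      forall x : M, exists b, chart_dom (B b) x &
      forall b, exists c, [/\ charts S c,
        closure (chart_dom (B b)) `<=` chart_dom c &
        {in chart_dom (B b), B b =1 c}]].

Definition Cl (S : smooth_structure) (l : nat) (f : M -> R[i]) : Prop :=
  forall c, charts S c -> complex_Cl_on l (chart_img c) (f \o chart_inv c).

Definition smooth (S : smooth_structure) (f : M -> R[i]) : Prop :=
  forall l, Cl S l f.

Definition Cl_norm (r : nat) (B : 'I_r -> chart) (l : nat) (f : M -> R[i]) :
    \bar R :=
  (\sum_(b < r) Cl_norm_on l (chart_img (B b)) (f \o chart_inv (B b)))%E.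

Definition dense_in_Cl (S : smooth_structure) (r : nat) (B : 'I_r -> chart)
    (l : nat) (E : set (M -> R[i])) : Prop :=
  forall h, Cl S l h -> forall e : R, 0 < e ->
    exists2 g, E g & (Cl_norm B l (fun x => (h x - g x)%R) < e%:E)%E.

(* The functions P/Q \o F with P, Q polynomials, Q without zeros on F(M). *)
Definition rational_in (n : nat) (f : 'I_n -> M -> R[i]) : set (M -> R[i]) :=
  [set g | exists P Q : mpoly n R[i],
     (forall x, meval (f ^~ x) Q != 0) /\
     g = (fun x => meval (f ^~ x) P / meval (f ^~ x) Q)].

Definition polynomial_in (n : nat) (f : 'I_n -> M -> R[i]) : set (M -> R[i]) :=
  [set g | exists P : mpoly n R[i], g = (fun x => meval (f ^~ x) P)].

Definition RD_basis (S : smooth_structure) (r : nat) (B : 'I_r -> chart)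
    (l n : nat) (f : 'I_n -> M -> R[i]) : Prop :=
  (forall i, smooth S (f i)) /\ dense_in_Cl S B l (rational_in f).

Definition PD_basis (S : smooth_structure) (r : nat) (B : 'I_r -> chart)
    (l n : nat) (f : 'I_n -> M -> R[i]) : Prop :=
  (forall i, smooth S (f i)) /\ dense_in_Cl S B l (polynomial_in f).

(* The family f_1, ..., f_n, g. *)
Definition family_rcons (n : nat) (f : 'I_n -> M -> R[i]) (g : M -> R[i]) :
    'I_n.+1 -> M -> R[i] :=
  fun i => oapp f g (unlift ord_max i).

End Manifolds.

(* Main.v *)
(** Let q_0, q_1, ... run through the polynomials with coefficients in Q[i]
    without zeros on F(M), each of them infinitely often, and put
      g = sum_i w_i / (q_0 ... q_i) \o F
    with very rapidly decreasing weights w_i > 0. Multiplying by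
    d_j = q_0 ... q_(j-1) turns the terms i < j into polynomials in F, and the
    term i = j into w_j / q_j; hence 1 / q_j differs from a polynomial in F and g
    by (d_j / w_j) * sum_(i > j) w_i / (q_0 ... q_i), which tends to 0 in C^l.
    As each q_j recurs, every 1 / q_j is a limit of polynomials in F and g, and
    then so is every P / Q, because Q can be approximated by some q_j.

    The maximal atlas is uncountable, so that smoothness of g is not a matter of
    countably many seminorms. Instead, the derivatives of order <= s of
    1 / (q_0 ... q_i) \o F at a point of any chart are bounded in terms of a bound
    C for those of F at that point in that chart, and w_i is chosen against the
    bounds for s <= i and C = i; at each point this covers all large i. *)

Require Import Defs.
From HB Require Import structures.
From mathcomp Require Import all_boot all_order all_algebra.
From mathcomp Require Import complex.
From mathcomp Require Import -(notations) mpoly.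
From mathcomp Require Import all_classical all_reals all_analysis.
From mathcomp Require Import lra ring.
Import Order.TTheory GRing.Theory Num.Theory numFieldNormedType.Exports.
Local Open Scope classical_set_scope.
Local Open Scope ring_scope.
Local Open Scope complex_scope.

Set Implicit Arguments.
Unset Strict Implicit.
Unset Printing Implicit Defensive.

(** * Iterated partial derivatives at a point *)

Section Calculus.
Variables (R : realType) (m : nat).
Implicit Types (W : set 'rV[R]_m) (u v : 'rV[R]_m -> R) (x : 'rV[R]_m).

(** The bound lives at a single point, so estimates in terms of it can be uniform in charts and
    points. The recursion mirrors [Cl_on], which lets the rules for products and inverses go by
    induction on the order. *)
Fixpoint bounded_jet (s : nat) u x (C : R) : Prop :=
  `|u x| <= C /\
  if s is s'.+1 then forall i : 'I_m, bounded_jet s' (partial i u) x C else True.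

Lemma bounded_jet0 s u x C : bounded_jet s u x C -> `|u x| <= C.
Proof. by case: s => [|s] []. Qed.

Lemma bounded_jet_partial s u x C i : bounded_jet s.+1 u x C ->
  bounded_jet s (partial i u) x C.
Proof. by move=> [_ h]; exact: h. Qed.

Lemma bounded_jet_le s u x C D : C <= D -> bounded_jet s u x C ->
  bounded_jet s u x D.
Proof.
move=> CD; elim: s u => [|s IH] u /= [uC h]; split => //.
- exact: le_trans CD.
- exact: le_trans CD.
- by move=> i; apply: IH.
Qed.

Lemma bounded_jet_leq s t u x C : (s <= t)%N -> bounded_jet t u x C ->
  bounded_jet s u x C.
Proof.
elim: s t u => [|s IH] [|t] u //= st [uC h]; split => // i.
exact: IH (h i).
Qed.

Lemma near_open W u v x : open W -> W x -> {in W, u =1 v} ->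
  \forall y \near x, u y = v y.
Proof.
move=> oW Wx uv; have : \forall y \near x, W y by exact: open_nbhs_nbhs.
by apply: filterS => y Wy; apply: uv; rewrite inE.
Qed.

Lemma partial_eq W u v i : open W -> {in W, u =1 v} ->
  {in W, partial i u =1 partial i v}.
Proof.
move=> oW uv x; rewrite inE => Wx; apply: near_eq_derive.
exact: near_open oW Wx uv.
Qed.

Lemma bounded_jet_eq W s u v x C : open W -> W x -> {in W, u =1 v} ->
  bounded_jet s u x C -> bounded_jet s v x C.
Proof.
move=> oW Wx; elim: s u v => [|s IH] u v uv /= [uC h].
  by rewrite -uv ?inE.
split; first by rewrite -uv ?inE.
by move=> i; apply: IH (h i); exact: partial_eq oW uv.
Qed.

Lemma Cl_on_eq W s u v : open W -> {in W, u =1 v} -> Cl_on s W u -> Cl_on s W v.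
Proof.
move=> oW.
have C0 (w w' : 'rV[R]_m -> R) : {in W, w =1 w'} -> {in W, continuous w} -> {in W, continuous w'}.
  move=> ww' cw x Wx; rewrite /continuous_at -ww' //.
  apply: cvg_trans (cw x Wx); apply: (@near_eq_cvg _ _ (nbhs x)).
  by move: (Wx); rewrite inE => Wx2; apply: filterS (near_open oW Wx2 ww') => y ->.
elim: s u v => [|s IH] u v uv; first exact: C0.
case=> cu h; split; first exact: C0 cu.
move=> i; have [du Du] := h i; split.
  move=> x Wx; apply: near_eq_derivable (du x Wx).
  by move: (Wx); rewrite inE => Wx2; exact: near_open oW Wx2 uv.
by apply: IH Du; exact: partial_eq.
Qed.

Lemma Cl_on_leq W s t u : (s <= t)%N -> Cl_on t W u -> Cl_on s W u.
Proof.
elim: s t u => [|s IH] [|t] u // st; first by case.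
case=> cu h; split => // i; have [du Du] := h i.
by split => //; exact: IH Du.
Qed.

Lemma Cl_on_pred W s u : Cl_on s.+1 W u -> Cl_on s W u.
Proof. exact: Cl_on_leq. Qed.

Lemma Cl_on_partial W s u i : Cl_on s.+1 W u -> Cl_on s W (partial i u).
Proof. by case=> _ /(_ i)[]. Qed.

Lemma partial_cst (c : R) i : partial i (fun=> c) = (fun=> 0) :> ('rV[R]_m -> R).
Proof. by apply/funext => x; rewrite /partial derive_cst. Qed.

Lemma Cl_on_cst W s (c : R) : Cl_on s W (fun=> c).
Proof.
elim: s c => [|s IH] c; first by move=> x _; exact: cst_continuous.
split; first by move=> x _; exact: cst_continuous.
move=> i; split; first by move=> x _; exact: derivable_cst.
by rewrite partial_cst.
Qed.

Lemma bounded_jet_cst s (c : R) x : bounded_jet s (fun=> c) x `|c|.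
Proof.
suff H C : `|c| <= C -> bounded_jet s (fun=> c) x C by exact: H.
elim: s c => [|s IH] c cC //; split => // i.
by rewrite partial_cst; apply: IH; rewrite normr0 (le_trans _ cC).
Qed.

Section Operations.
Variable W : set 'rV[R]_m.
Hypothesis oW : open W.

Lemma partialD s u v i : Cl_on s.+1 W u -> Cl_on s.+1 W v ->
  {in W, partial i (fun y => u y + v y) =1 fun y => partial i u y + partial i v y}.
Proof.
move=> [_ /(_ i)[du _]] [_ /(_ i)[dv _]] x Wx.
by rewrite /partial -(deriveD (du _ Wx) (dv _ Wx)).
Qed.

Lemma partialM s u v i : Cl_on s.+1 W u -> Cl_on s.+1 W v ->
  {in W, partial i (fun y => u y * v y) =1
         fun y => u y * partial i v y + v y * partial i u y}.
Proof.
move=> [_ /(_ i)[du _]] [_ /(_ i)[dv _]] x Wx.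
by rewrite /partial -(deriveM (du _ Wx) (dv _ Wx)).
Qed.

(** The derivative is arranged as a scalar times a product of functions, the shape to which
    [Cl_onM], [bounded_jetM] and [bounded_jetZ] apply. *)
Lemma partialV s u i : (forall x, W x -> u x != 0) -> Cl_on s.+1 W u ->
  {in W, partial i (fun y => (u y)^-1) =1
         fun y => -1 * ((u y)^-1 * (u y)^-1 * partial i u y)}.
Proof.
move=> u0 [_ /(_ i)[du _]] x Wx.
have ux : u x != 0 by apply: u0; rewrite inE in Wx.
rewrite /partial (deriveV ux (du _ Wx)).
by rewrite scaleNr mulN1r -expr2 exprVn.
Qed.

Lemma Cl_onD s u v : Cl_on s W u -> Cl_on s W v -> Cl_on s W (fun y => u y + v y).
Proof.
have C0 u' v' : {in W, continuous u'} -> {in W, continuous v'} ->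
    {in W, continuous (fun y => u' y + v' y)}.
  by move=> cu cv x Wx; exact: (continuousD (cu x Wx) (cv x Wx)).
elim: s u v => [|s IH] u v; first exact: C0.
move=> Cu Cv; have [[cu hu] [cv hv]] := (Cu, Cv).
split; first exact: C0.
move=> i; have [[du Du] [dv Dv]] := (hu i, hv i); split.
  by move=> x Wx; exact: (derivableD (du x Wx) (dv x Wx)).
apply: Cl_on_eq (IH _ _ Du Dv) => //.
by move=> x Wx /=; rewrite (partialD _ Cu Cv).
Qed.

Lemma Cl_onM s u v : Cl_on s W u -> Cl_on s W v -> Cl_on s W (fun y => u y * v y).
Proof.
have C0 u' v' : {in W, continuous u'} -> {in W, continuous v'} ->
    {in W, continuous (fun y => u' y * v' y)}.
  by move=> cu cv x Wx; exact: (continuousM (cu x Wx) (cv x Wx)).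
elim: s u v => [|s IH] u v; first exact: C0.
move=> Cu Cv; have [[cu hu] [cv hv]] := (Cu, Cv).
split; first exact: C0.
move=> i; have [[du Du] [dv Dv]] := (hu i, hv i); split.
  by move=> x Wx; exact: (derivableM (du x Wx) (dv x Wx)).
apply: Cl_on_eq (Cl_onD (IH _ _ (Cl_on_pred Cu) Dv) (IH _ _ (Cl_on_pred Cv) Du)) => //.
by move=> x Wx /=; rewrite (partialM _ Cu Cv).
Qed.

(** Induction on the order: the derivative of an inverse involves only the inverse itself and the
    derivative of [u], both of class one lower. *)
Lemma Cl_onV s u : (forall x, W x -> u x != 0) -> Cl_on s W u ->
  Cl_on s W (fun y => (u y)^-1).
Proof.
move=> u0.
have C0 : {in W, continuous u} -> {in W, continuous (fun y => (u y)^-1)}.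
  by move=> cu x Wx; apply: (continuousV _ (cu x Wx)); apply: u0; rewrite inE in Wx.
elim: s => [|s IH] Cu; first exact: C0.
have [cu hu] := Cu; split; first exact: C0.
move=> i; have [du Du] := hu i; split.
  by move=> x Wx; apply: (derivableV _ (du x Wx)); apply: u0; rewrite inE in Wx.
have Ci := IH (Cl_on_pred Cu).
apply: Cl_on_eq (Cl_onM (Cl_on_cst _ _ (-1)) (Cl_onM (Cl_onM Ci Ci) Du)) => //.
by move=> x Wx /=; rewrite (partialV _ u0 Cu).
Qed.

Lemma bounded_jetD s u v x A B : W x -> Cl_on s W u -> Cl_on s W v ->
  bounded_jet s u x A -> bounded_jet s v x B ->
  bounded_jet s (fun y => u y + v y) x (A + B).
Proof.
move=> Wx; elim: s u v => [|s IH] u v Cu Cv [uA hu] [vB hv].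
  by split => //; rewrite (le_trans (ler_normD _ _)) ?lerD.
split; first by rewrite (le_trans (ler_normD _ _)) ?lerD.
move=> i; have Du := Cl_on_partial i Cu; have Dv := Cl_on_partial i Cv.
apply: bounded_jet_eq oW Wx _ (IH _ _ Du Dv (hu i) (hv i)).
by move=> y Wy /=; rewrite (partialD _ Cu Cv).
Qed.

(** By the Leibniz rule each differentiation doubles the number of products, whence the factor
    [2 ^+ s]. *)
Lemma bounded_jetM s u v x A B : W x -> Cl_on s W u -> Cl_on s W v ->
  bounded_jet s u x A -> bounded_jet s v x B ->
  bounded_jet s (fun y => u y * v y) x (2 ^+ s * (A * B)).
Proof.
move=> Wx; elim: s u v A B => [|s IH] u v A B Cu Cv hu hv.
  have [uA vB] := (bounded_jet0 hu, bounded_jet0 hv).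
  by split => //; rewrite normrM expr0 mul1r ler_pM.
have [uA vB] := (bounded_jet0 hu, bounded_jet0 hv).
have A0 : 0 <= A by exact: le_trans uA.
have B0 : 0 <= B by exact: le_trans vB.
split.
  rewrite normrM (le_trans (ler_pM _ _ uA vB)) // ler_peMl ?mulr_ge0 //.
  by rewrite exprn_ege1 // ler1n.
move=> i; have Du := Cl_on_partial i Cu; have Dv := Cl_on_partial i Cv.
have Cu' := Cl_on_pred Cu; have Cv' := Cl_on_pred Cv.
have hu' := bounded_jet_leq (leqnSn s) hu.
have hv' := bounded_jet_leq (leqnSn s) hv.
have h1 := IH _ _ _ _ Cu' Dv hu' (bounded_jet_partial i hv).
have h2 := IH _ _ _ _ Cv' Du hv' (bounded_jet_partial i hu).
have := bounded_jetD Wx (Cl_onM Cu' Dv) (Cl_onM Cv' Du) h1 h2.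
have -> : 2 ^+ s * (A * B) + 2 ^+ s * (B * A) = 2 ^+ s.+1 * (A * B) by rewrite exprS; ring.
apply: bounded_jet_eq oW Wx _.
by move=> y Wy /=; rewrite (partialM _ Cu Cv).
Qed.

Lemma bounded_jetZ s u x (c A : R) : W x -> Cl_on s W u ->
  bounded_jet s u x A -> bounded_jet s (fun y => c * u y) x (`|c| * A).
Proof.
move=> Wx; elim: s u => [|s IH] u Cu hu.
  by split => //; rewrite normrM ler_wpM2l // (bounded_jet0 hu).
split; first by rewrite normrM ler_wpM2l // (bounded_jet0 hu).
move=> i; have Du := Cl_on_partial i Cu.
apply: bounded_jet_eq oW Wx _ (IH _ Du (bounded_jet_partial i hu)).
move=> y Wy /=; rewrite (partialM _ (Cl_on_cst _ _ c) Cu) //.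
by rewrite partial_cst mulr0 addr0.
Qed.

End Operations.

(** The constant is chosen before the set, the function and the point. This uniformity makes
    inverses of tame functions tame. *)
Lemma bounded_jetV s (C : R) : exists D : R, forall W u x, open W -> W x ->
  (forall y, W y -> u y != 0) -> Cl_on s W u ->
  bounded_jet s u x C -> `|(u x)^-1| <= C ->
  bounded_jet s (fun y => (u y)^-1) x D.
Proof.
elim: s => [|s [D HD]]; first by exists C => *; split.
(* The first entry bounds the value of the inverse; the second bounds the jet of its derivative by
   two applications of the product rule, with [D] from order [s]. *)
exists (Num.max C (`|-1| * (2 ^+ s * (2 ^+ s * (D * D) * C)))).
move=> W u x oW Wx u0 Cu hu uC.
split; first by rewrite le_max uC.
move=> i; have Du := Cl_on_partial i Cu.
have Cu' := Cl_on_pred Cu.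
have hu' := bounded_jet_leq (leqnSn s) hu.
have hV := HD W u x oW Wx u0 Cu' hu' uC.
have CV := Cl_onV oW u0 Cu'.
have h2 := bounded_jetM oW Wx CV CV hV hV.
have h3 := bounded_jetM oW Wx (Cl_onM oW CV CV) Du h2 (bounded_jet_partial i hu).
have h4 := bounded_jetZ oW (-1) Wx (Cl_onM oW (Cl_onM oW CV CV) Du) h3.
apply: (bounded_jet_le (C := `|-1| * (2 ^+ s * (2 ^+ s * (D * D) * C)))).
  by rewrite le_max lexx orbT.
apply: bounded_jet_eq oW Wx _ h4.
by move=> y Wy /=; rewrite (partialV _ u0 Cu).
Qed.

Lemma near_bounded_jet W s u x : open W -> W x -> Cl_on s W u ->
  exists C, \forall y \near x, bounded_jet s u y C.
Proof.
move=> oW Wx; have Wx' : x \in W by rewrite inE.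
have C0 v : {in W, continuous v} -> \forall y \near x, `|v y| <= `|v x| + 1.
  move=> cv; have /cvgrPdist_le/(_ 1 ltr01) := cv x Wx'.
  apply: filterS => y h; rewrite -[v y](subrK (v x)).
  by rewrite (le_trans (ler_normD _ _)) // addrC lerD2l distrC.
elim: s u => [|s IH] u Cu.
  by exists (`|u x| + 1); apply: filterS (C0 _ Cu).
have [cu hu] := Cu.
have [D HD] := choice (fun i => IH _ (hu i).2).
exists (\big[Num.max/(`|u x| + 1)]_i D i).
have : \forall y \near x, forall i, bounded_jet s (partial i u) y (D i).
  apply: (@filter_forall _ _ _ (nbhs x)) => i; exact: HD.
apply: filterS2 (C0 _ cu) => y hy Hy; split.
  by apply: (le_trans hy); exact: bigmax_ge_id.
by move=> i; apply: bounded_jet_le (Hy i); exact: le_bigmax.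
Qed.

End Calculus.
(** * Termwise differentiation of series *)

Section GeometricSeries.
Variable R : realType.
Implicit Types (a b : nat -> R).

Lemma sum_half_pow n p : \sum_(n <= j < p) (2^-1 : R) ^+ j <= 2 * 2^-1 ^+ n.
Proof.
have [np|pn] := leqP n p; last first.
  by rewrite big_geq ?(ltnW pn) // mulr_ge0 // exprn_ge0 // invr_ge0.
suff : \sum_(n <= j < p) (2^-1 : R) ^+ j = 2 * 2^-1 ^+ n - 2 * 2^-1 ^+ p.
  by move=> ->; rewrite gerBl mulr_ge0 // exprn_ge0 // invr_ge0.
elim: p np => [|p IH] np.
  by move: np; rewrite leqn0 => /eqP ->; rewrite big_geq // subrr.
move: np; rewrite leq_eqVlt => /orP[/eqP ->|np].
  by rewrite big_geq // subrr.
by rewrite big_nat_recr //= IH // exprS; field.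
Qed.

Lemma half_pow_small (e : R) : 0 < e -> exists n0, forall n, (n0 <= n)%N ->
  2^-1 ^+ n <= e.
Proof.
move=> e0; have h : `|2^-1 : R| < 1.
  by rewrite ger0_norm ?invr_ge0 // invf_lt1 // ltr1n.
have /cvgrPdist_le/(_ e e0)[n0 _ H] := cvg_expr h.
exists n0 => n nn0; have := H n nn0.
by rewrite /= sub0r normrN ger0_norm // exprn_ge0 // invr_ge0.
Qed.

Section Dominated.
Variables (a : nat -> R) (N : nat).
Hypothesis aN : forall j, (N <= j)%N -> `|a j| <= 2^-1 ^+ j.

Lemma dominated_tail n p : (N <= n)%N -> (n <= p)%N ->
  `|series a p - series a n| <= 2 * 2^-1 ^+ n.
Proof.
move=> Nn np; rewrite sub_series_geq //.
rewrite (le_trans (ler_norm_sum _ _ _)) // (le_trans _ (sum_half_pow n p)) //.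
by apply: ler_sum_nat => j /andP[nj _]; apply: aN; exact: leq_trans nj.
Qed.

Lemma dominated_cvg : cvgn (series a).
Proof.
apply: normed_cvg; apply: nondecreasing_is_cvgn.
  by apply: nondecreasing_series => n _ _; exact: normr_ge0.
exists (series (fun j => `|a j|) N + 2) => _ [n _ <-].
have [nN|Nn] := leqP n N.
  rewrite (le_trans (y := series (fun j => `|a j|) N)) ?lerDl //.
  by apply: (nondecreasing_series (P := xpredT)) => // i _ _; exact: normr_ge0.
rewrite addrC -lerBlDr sub_series_geq ?(ltnW Nn) //.
apply: (le_trans (y := \sum_(N <= j < n) 2^-1 ^+ j)).
  by apply: ler_sum_nat => j /andP[nj _]; exact: aN.
rewrite (le_trans (sum_half_pow _ _)) // ler_piMr //.
by rewrite exprn_ile1 ?invr_ge0 // invf_le1 // ler1n.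
Qed.

Lemma dominated_lim n : (N <= n)%N ->
  `|limn (series a) - series a n| <= 2 * 2^-1 ^+ n.
Proof.
move=> Nn.
have h : (fun p => `|series a p - series a n|) @ \oo -->
    `|limn (series a) - series a n|.
  by apply: cvg_norm; apply: cvgB; [exact: dominated_cvg|exact: cvg_cst].
rewrite -(cvg_lim _ h) //; apply: limr_le; first by apply/cvg_ex; eexists; exact: h.
by exists n => // p np; exact: dominated_tail.
Qed.

End Dominated.

(** Dominated convergence for series: the tails are small uniformly in [t], and a finite partial sum
    converges term by term. An arbitrary filter covers both continuity at a point and limits of
    difference quotients. *)
Lemma dominated_exchange (T : Type) (F : set_system T) (FF : Filter F)
    (a : nat -> T -> R) (b : nat -> R) N :
  (\forall t \near F, forall j, (N <= j)%N -> `|a j t| <= 2^-1 ^+ j) ->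
  (forall j, (N <= j)%N -> `|b j| <= 2^-1 ^+ j) ->
  (forall j, a j t @[t --> F] --> b j) ->
  limn (series (a ^~ t)) @[t --> F] --> limn (series b).
Proof.
move=> aN bN ab; apply/cvgrPdist_le => e e0.
(* A tail costs twice the power of one half, so [e / 6] keeps each of the two tails below
   [e / 3]. *)
have e6 : 0 < e / 6 by rewrite divr_gt0.
have [n0 Hn0] := half_pow_small e6.
pose n := maxn N n0.
have Nn : (N <= n)%N by exact: leq_maxl.
have := Hn0 n (leq_maxr _ _) => en.
have : series (a ^~ t) n @[t --> F] --> series b n.
  rewrite /series /= ; elim: n {Nn en} => [|n IH].
    rewrite big_geq //; under eq_fun do rewrite big_geq //.
    exact: cvg_cst.
  rewrite big_nat_recr //=; under eq_fun do rewrite big_nat_recr //=.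
  by apply: cvgD.
have e3 : 0 < e / 3 by rewrite divr_gt0.
move=> /cvgrPdist_le/(_ _ e3); apply: filterS2 aN => t aNt H.
have h1 := dominated_lim bN Nn.
have h2 := dominated_lim aNt Nn.
rewrite distrC in h2.
have -> : limn (series b) - limn (series (a^~ t)) =
  (limn (series b) - series b n) + (series b n - series (a^~ t) n) +
  (series (a ^~ t) n - limn (series (a^~ t))) by ring.
rewrite (le_trans (ler_normD _ _)) // (le_trans (lerD (ler_normD _ _) (le_refl _))) //.
lra.
Qed.

End GeometricSeries.

Section DirectionalMVT.
Variables (R : realType) (m : nat).

Lemma derive_along (u : 'rV[R]_m -> R) x e s :
  derivable u (s *: e + x) e ->
  is_derive s (1 : R) (fun t => u (t *: e + x)) ('D_e u (s *: e + x)).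
Proof.
move=> du.
have E : (fun h : R => h^-1 *: (((fun t => u (t *: e + x)) \o shift s) (h *: 1) - u (s *: e + x))) =
         (fun h : R => h^-1 *: ((u \o shift (s *: e + x)) (h *: e) - u (s *: e + x))).
  by apply/funext => h /=; rewrite scalerDl addrA [h *: 1]mulr1.
by split; rewrite /derivable /derive /= E.
Qed.

(** The mean value theorem on the line through [x] in direction [e]. The condition on the absolute
    value of [s] covers the segment from 0 to [t] for either sign of [t]. *)
Lemma derive_lipschitz (u : 'rV[R]_m -> R) x e (c t : R) :
  (forall s, `|s| <= `|t| -> derivable u (s *: e + x) e) ->
  (forall s, `|s| <= `|t| -> `|'D_e u (s *: e + x)| <= c) ->
  `|u (t *: e + x) - u x| <= c * `|t|.
Proof.
move=> du Du; pose phi (s : R) := u (s *: e + x).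
have P a b : a <= b -> (forall s, a <= s <= b -> `|s| <= `|t|) ->
    `|phi b - phi a| <= c * `|b - a|.
  move=> ab H.
  have dphi s : a <= s <= b -> is_derive s 1 phi ('D_e u (s *: e + x)).
    by move=> /H st; apply: derive_along; exact: du.
  have [||s sab ->] := @MVT_segment R phi (fun s => 'D_e u (s *: e + x)) a b ab.
  - move=> s; rewrite in_itv /= => /andP[as_ sb]; apply: dphi.
    by rewrite (ltW as_) (ltW sb).
  - apply: derivable_within_continuous => s; rewrite in_itv /= => /dphi [].
    by [].
  rewrite normrM ler_wpM2r // Du // H //.
have <- : phi t = u (t *: e + x) by [].
have <- : phi 0 = u x by rewrite /phi scale0r add0r.
have [t0|t0] := leP 0 t.
  have := P 0 t t0; rewrite subr0; apply => s /andP[s0 st].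
  by rewrite !ger0_norm.
have := P t 0 (ltW t0); rewrite sub0r normrN distrC; apply => s /andP[ts s0].
by rewrite !ler0_norm ?(ltW t0) // lerN2.
Qed.

End DirectionalMVT.
Section FunctionSeries.
Variables (R : realType) (m : nat).
Implicit Types (W : set 'rV[R]_m) (U : nat -> 'rV[R]_m -> R) (x : 'rV[R]_m).

Definition series_sum U x := limn (series (fun j => U j x)).

(** Domination by a geometric series, local in the point and separate for each order: the index [N]
    may depend on both. *)
Definition jet_summable W U := forall s x, W x -> exists N,
  \forall y \near x, forall j, (N <= j)%N -> bounded_jet s (U j) y (2^-1 ^+ j).

Lemma jet_summable_partial W U i : jet_summable W U ->
  jet_summable W (fun j => partial i (U j)).
Proof.
move=> H s x Wx; have [N HN] := H s.+1 x Wx; exists N.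
by apply: filterS HN => y h j /h /bounded_jet_partial.
Qed.

Lemma jet_summable_cvg W U x : jet_summable W U -> W x ->
  cvgn (series (fun j => U j x)).
Proof.
move=> H Wx; have [N /nbhs_singleton HN] := H 0%N x Wx.
by apply: (@dominated_cvg _ _ N) => j /HN /bounded_jet0.
Qed.

Lemma series_sum_continuous W U : (forall j, {in W, continuous (U j)}) ->
  jet_summable W U -> {in W, continuous (series_sum U)}.
Proof.
move=> cU H x Wx; have [N HN] := H 0%N x (set_mem Wx).
apply: (@dominated_exchange R _ (nbhs x) _ U (U ^~ x) N).
- by apply: filterS HN => y h j /h /bounded_jet0.
- by move=> j; have /nbhs_singleton/(_ j) h := HN => /h /bounded_jet0.
- by move=> j; exact: cU.
Qed.

Lemma near_line x (e : 'rV[R]_m) (P : 'rV[R]_m -> Prop) :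
  (\forall y \near x, P y) ->
  \forall t \near (0 : R), forall s, `|s| <= `|t| -> P (s *: e + x).
Proof.
move=> Px; have c : (s *: e + x) @[s --> (0 : R)] --> x.
  rewrite -[X in _ --> X]add0r -(scale0r e).
  by apply: cvgD; [apply: cvgZr_tmp; exact: cvg_id|exact: cvg_cst].
have /nbhs_ballP[d /= d0 H] := c _ Px.
apply/nbhs_ballP; exists d => //= t; rewrite /ball /= sub0r normrN => td s st.
by apply: H; rewrite /ball /= sub0r normrN (le_lt_trans st).
Qed.

(** By the mean value theorem the difference quotients of the terms inherit the geometric bounds of
    the first derivatives. Hence [dominated_exchange] along the punctured neighbourhoods of 0 moves
    the limit inside the sum. *)
Lemma series_sum_derive W U i : open W -> (forall j, Cl_on 1 W (U j)) ->
  jet_summable W U -> forall x, W x ->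
  is_derive x (delta_mx 0 i) (series_sum U) (series_sum (fun j => partial i (U j)) x).
Proof.
move=> oW cU H x Wx; set e := delta_mx 0 i.
have [N HN] := H 1%N x Wx.
have nW : \forall y \near x, W y by exact: open_nbhs_nbhs.
have dU j y : W y -> derivable (U j) y e.
  by move=> Wy; have [_ /(_ i)[h _]] := cU j; apply: h; rewrite inE.
suff D : (fun h : R => h^-1 *: (((series_sum U) \o shift x) (h *: e) - series_sum U x)) @ 0^'
    --> series_sum (fun j => partial i (U j)) x.
  by split; [apply/cvg_ex; eexists; exact: D|exact: cvg_lim D].
pose a j (t : R) := t^-1 *: ((U j \o shift x) (t *: e) - U j x).
have := @dominated_exchange R _ (0 : R)^' _ a (fun j => partial i (U j) x) N.
rewrite -/(series_sum (fun j => partial i (U j)) x) => K.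
(* The bounds are required on the whole segment, as the mean value theorem evaluates the derivative
   at an unknown intermediate point. *)
have near1 : \forall t \near (0 : R)^', forall s, `|s| <= `|t| -> W (s *: e + x) /\
    forall j, (N <= j)%N -> bounded_jet 1 (U j) (s *: e + x) (2^-1 ^+ j).
  have HW : \forall y \near x, W y /\ forall j, (N <= j)%N -> bounded_jet 1 (U j) y (2^-1 ^+ j).
    by near=> y; split; [near: y|near: y].
  exact: (nbhs_dnbhs (near_line e HW)).
have near2 : \forall t \near (0 : R)^', (t : R) != 0 by exact: nbhs_dnbhs_neq.
have {}K : limn (series (a ^~ t)) @[t --> (0 : R)^'] --> series_sum (fun j => partial i (U j)) x.
  apply: K.
  - near=> t => j Nj.
    have t0 : t != 0 by near: t.
    have Ht : forall s, `|s| <= `|t| -> W (s *: e + x) /\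
      forall j, (N <= j)%N -> bounded_jet 1 (U j) (s *: e + x) (2^-1 ^+ j) by near: t.
    rewrite /a normrZ normfV mulrC ler_pdivrMr ?normr_gt0 //=.
    apply: derive_lipschitz.
    + by move=> s /Ht[/dU].
    + by move=> s /Ht[_ /(_ j Nj) [_ /(_ i) []]].
  - move=> j Nj; have /nbhs_singleton/(_ j Nj) := HN.
    by move=> /(bounded_jet_partial i)/bounded_jet0.
  - move=> j; exact: dU.
apply: cvg_trans K; apply: near_eq_cvg; near=> t.
have Wt : W (t *: e + x).
  have Ht : forall s, `|s| <= `|t| -> W (s *: e + x) /\
      forall j, (N <= j)%N -> bounded_jet 1 (U j) (s *: e + x) (2^-1 ^+ j) by near: t.
  by have [] := Ht t (le_refl _).
have c1 := jet_summable_cvg H Wt; have c2 := jet_summable_cvg H Wx.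
rewrite /= /series_sum /a.
have -> : series (fun j => t^-1 *: ((U j \o shift x) (t *: e) - U j x)) =
  (fun n => t^-1 * (series (fun j => U j (t *: e + x)) n - series (fun j => U j x) n)).
  by apply/funext => n; rewrite /series /= -sumrB mulr_sumr.
by apply: cvg_lim => //; apply: cvgMl_tmp; exact: cvgB.
Unshelve. all: by end_near. Qed.

Lemma series_sum_Cl_on W U l : open W -> (forall j, smooth_on W (U j)) ->
  jet_summable W U -> Cl_on l W (series_sum U).
Proof.
move=> oW; elim: l U => [|l IH] U sU H.
  by apply: series_sum_continuous H => j; exact: (sU j 0%N).
split; first by apply: series_sum_continuous H => j; exact: (sU j 0%N).
move=> i; have D := series_sum_derive i oW (fun j => sU j 1%N) H.
split; first by move=> x /set_mem /D [].
apply: Cl_on_eq (IH (fun j => partial i (U j)) _ (jet_summable_partial i H)) => //.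
  by move=> x /set_mem /D [_ <-].
by move=> j k; apply: Cl_on_partial; exact: sU.
Qed.

Lemma series_sum_bounded_jet W U s x (b : nat -> R) B : open W -> W x ->
  (forall j, smooth_on W (U j)) -> jet_summable W U ->
  (forall j, bounded_jet s (U j) x (b j)) -> (forall n, series b n <= B) ->
  bounded_jet s (series_sum U) x B.
Proof.
move=> oW Wx + + + bB; elim: s U => [|s IH] U sU H Ub.
all: have S0 : `|series_sum U x| <= B.
1,3: have c := jet_summable_cvg H Wx; rewrite -[X in X <= _](cvg_lim _ (cvg_norm c)) //;
  apply: limr_le; [by apply/cvg_ex; eexists; exact: cvg_norm c|];
  apply: nearW => n; apply: le_trans (bB n); rewrite /series /=;
  rewrite (le_trans (ler_norm_sum _ _ _)) //; apply: ler_sum => j _;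
  exact: bounded_jet0 (Ub j).
- by split.
split => // i.
have D := series_sum_derive i oW (fun j => sU j 1%N) H.
have h : bounded_jet s (series_sum (fun j => partial i (U j))) x B.
  apply: IH; [|exact: jet_summable_partial|by move=> j; exact: bounded_jet_partial].
  by move=> j k; apply: Cl_on_partial; exact: sU.
apply: bounded_jet_eq oW Wx _ h.
by move=> y /set_mem /D [_ <-].
Qed.

End FunctionSeries.
(** * The C^l-norm *)

Section ClNorm.
Variables (R : realType) (m : nat) (W : set 'rV[R]_m).
Hypothesis oW : open W.
Implicit Types (u v : 'rV[R]_m -> R) (h : 'rV[R]_m -> R[i]) (a : multinom m).

(** [partials] with the enumeration of the variables replaced by an arbitrary list, so that
    induction on the list is possible. *)
Let fold_partial a s u := foldr (fun i v => iter (a i) (partial i) v) u s.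

Lemma iter_partial_jet s k i u x C : bounded_jet (k + s) u x C ->
  bounded_jet s (iter k (partial i) u) x C.
Proof.
elim: k u => [|k IH] u // h; rewrite iterSr; apply: IH.
exact: bounded_jet_partial.
Qed.

Lemma iter_partial_Cl_on s k i u : Cl_on (k + s) W u ->
  Cl_on s W (iter k (partial i) u).
Proof.
elim: k u => [|k IH] u // h; rewrite iterSr; apply: IH.
exact: Cl_on_partial.
Qed.

Lemma iter_partial_eq k i u v : {in W, u =1 v} ->
  {in W, iter k (partial i) u =1 iter k (partial i) v}.
Proof. by move=> uv; elim: k => [|k IH] //=; exact: partial_eq. Qed.

Lemma iter_partialD k i u v : Cl_on k W u -> Cl_on k W v ->
  {in W, iter k (partial i) (fun y => u y + v y) =1
    fun y => iter k (partial i) u y + iter k (partial i) v y}.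
Proof.
elim: k u v => [|k IH] u v // Cu Cv x Wx; rewrite !iterSr.
rewrite (iter_partial_eq k i (partialD i Cu Cv)) //.
by apply: IH => //; exact: Cl_on_partial.
Qed.

Lemma fold_partial_jet a s t u x C :
  bounded_jet (\sum_(i <- s) a i + t) u x C ->
  bounded_jet t (fold_partial a s u) x C.
Proof.
elim: s t => [|i s IH] t /=; first by rewrite big_nil.
by rewrite big_cons => h; apply: iter_partial_jet; apply: IH; rewrite addnA (addnC _ (a i)).
Qed.

Lemma fold_partial_Cl_on a s t u :
  Cl_on (\sum_(i <- s) a i + t) W u -> Cl_on t W (fold_partial a s u).
Proof.
elim: s t => [|i s IH] t /=; first by rewrite big_nil.
by rewrite big_cons => h; apply: iter_partial_Cl_on; apply: IH; rewrite addnA (addnC _ (a i)).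
Qed.

Lemma fold_partialD a s u v :
  Cl_on (\sum_(i <- s) a i) W u -> Cl_on (\sum_(i <- s) a i) W v ->
  {in W, fold_partial a s (fun y => u y + v y) =1
    fun y => fold_partial a s u y + fold_partial a s v y}.
Proof.
elim: s => [|i s IH] //=; rewrite big_cons => Cu Cv x Wx.
have sub w : Cl_on (a i + \sum_(j <- s) a j) W w -> Cl_on (\sum_(j <- s) a j) W w.
  by apply: Cl_on_leq; exact: leq_addl.
have fC w : Cl_on (a i + \sum_(j <- s) a j) W w -> Cl_on (a i) W (fold_partial a s w).
  by rewrite addnC; exact: fold_partial_Cl_on.
rewrite (iter_partial_eq (a i) i (IH (sub _ Cu) (sub _ Cv))) //.
by apply: iter_partialD => //; exact: fC.
Qed.

Lemma sum_enum_mdeg a : (\sum_(i <- enum 'I_m) a i)%N = mdeg a.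
Proof. by rewrite mdegE big_enum. Qed.

Lemma partials_bounded l a u x C : (mdeg a <= l)%N -> bounded_jet l u x C ->
  `|partials a u x| <= C.
Proof.
move=> al /(bounded_jet_leq al) h; apply: (bounded_jet0 (s := 0)).
by apply: fold_partial_jet; rewrite addn0 sum_enum_mdeg.
Qed.

Lemma partialsD l a u v x : (mdeg a <= l)%N -> Cl_on l W u -> Cl_on l W v ->
  W x -> partials a (fun y => u y + v y) x = partials a u x + partials a v x.
Proof.
move=> al Cu Cv Wx; apply: fold_partialD; rewrite ?inE // sum_enum_mdeg;
  exact: Cl_on_leq al _.
Qed.

Lemma normc_le (z : R[i]) : Normc.normc z <= `|complex.Re z| + `|complex.Im z|.
Proof.
case: z => p q /=; rewrite -(ler_pXn2r (n := 2)) ?nnegrE ?sqrtr_ge0 ?addr_ge0 //.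
rewrite sqr_sqrtr ?addr_ge0 ?sqr_ge0 // sqrrD !real_normK ?num_real //.
by rewrite -addrA lerD2l lerDr mulrn_wge0 // mulr_ge0.
Qed.

Lemma complex_Cl_onD l h h' : complex_Cl_on l W h -> complex_Cl_on l W h' ->
  complex_Cl_on l W (fun y => h y + h' y).
Proof.
move=> [hr hi] [h'r h'i]; split.
  apply: Cl_on_eq (Cl_onD oW hr h'r) => // y _.
  by case: (h y) (h' y) => ? ? [].
apply: Cl_on_eq (Cl_onD oW hi h'i) => // y _.
by case: (h y) (h' y) => ? ? [].
Qed.

(** The passage from pointwise jets to the norm: the cardinal counts the multi-indices, and [C + C]
    adds the real and imaginary parts. *)
Lemma Cl_norm_on_le l h C : 0 <= C ->
  (forall x, W x -> bounded_jet l (fun y => complex.Re (h y)) x C /\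
                    bounded_jet l (fun y => complex.Im (h y)) x C) ->
  (Cl_norm_on l W h <= (#|{: bmultinom m l.+1}|%:R * (C + C))%:E)%E.
Proof.
move=> C0 H; rewrite /Cl_norm_on.
have -> : (#|{: bmultinom m l.+1}|%:R * (C + C))%:E =
    (\sum_(a : bmultinom m l.+1) (C + C)%:E)%E.
  by rewrite sumEFin sumr_const mulr_natl.
apply: lee_sum => a _; rewrite ge_max lee_fin addr_ge0 // andTb.
apply: ge_ereal_sup => _ [x Wx <-]; rewrite lee_fin.
have [h1 h2] := H x Wx.
have al : (mdeg a <= l)%N by have := bmdeg a.
apply: (le_trans (normc_le _)); apply: lerD => /=.
  exact: partials_bounded al h1.
exact: partials_bounded al h2.
Qed.

Lemma Cl_norm_onD l h h' : complex_Cl_on l W h -> complex_Cl_on l W h' ->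
  (Cl_norm_on l W (fun y => h y + h' y)%R <= Cl_norm_on l W h + Cl_norm_on l W h')%E.
Proof.
move=> [hr hi] [h'r h'i]; rewrite /Cl_norm_on -big_split /=.
apply: lee_sum => a _.
have al : (mdeg a <= l)%N by have := bmdeg a.
rewrite ge_max adde_ge0 ?le_max ?lexx // andTb.
apply: ge_ereal_sup => _ [x Wx <-].
have E : complex_partials a (fun y => h y + h' y) x =
    complex_partials a h x + complex_partials a h' x.
  have Er : (fun y => complex.Re (h y + h' y)) =
      (fun y => complex.Re (h y) + complex.Re (h' y)).
    by apply/funext => y; case: (h y) (h' y) => ? ? [].
  have Ei : (fun y => complex.Im (h y + h' y)) =
      (fun y => complex.Im (h y) + complex.Im (h' y)).
    by apply/funext => y; case: (h y) (h' y) => ? ? [].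
  rewrite /complex_partials Er Ei.
  by rewrite (partialsD al hr h'r Wx) (partialsD al hi h'i Wx).
have K : Normc.normc (complex_partials a (fun y => h y + h' y) x) <=
    Normc.normc (complex_partials a h x) + Normc.normc (complex_partials a h' x).
  by rewrite E; exact: le_normcD.
apply: (@le_trans _ _ ((Normc.normc (complex_partials a h x))%:E +
    (Normc.normc (complex_partials a h' x))%:E)%E).
  by rewrite -EFinD lee_fin; exact: K.
by apply: leeD; rewrite le_max; apply/orP; right; apply: ereal_sup_ubound; exists x.
Qed.

End ClNorm.
(** * Functions whose derivatives are controlled by those of F *)

Section EventualBounds.
Variable R : realType.

Lemma finite_uniform_bound (I : finType) (P : I -> R -> Prop) :
  (forall i C D, C <= D -> P i C -> P i D) ->
  (forall i, exists C, P i C) -> exists C, forall i, P i C.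
Proof.
move=> Pmono /choice[C PC]; exists (\big[Num.max/0]_i C i) => i.
by apply: Pmono (PC i); exact: le_bigmax.
Qed.

(** Compactness in its near-covering form, with the filter at [+oo] as the parameter: local bounds,
    being monotone in the constant, hold on all of [K] for every large constant. *)
Lemma compact_uniform_bound (T : topologicalType) (K : set T) (P : R -> T -> Prop) :
  compact K -> (forall C D p, C <= D -> P C p -> P D p) ->
  (forall p, K p -> exists C, \forall q \near p, P C q) ->
  exists C, forall p, K p -> P C p.
Proof.
move=> /compact_near_coveringP cK Pmono H.
have [C [_ HC]] : \forall C \near +oo, K `<=` P C.
  apply: cK => p Kp; have [C HC] := H p Kp.
  exists ([set q | P C q], [set D | C < D]); first by split => //=; exists C; rewrite ?num_real.
  by move=> [q D] /= [PCq CD]; exact: Pmono (ltW CD) PCq.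
(* Neighbourhoods of [+oo] are given by strict inequalities, so [C] itself need not qualify. *)
by exists (C + 1) => p; apply: HC; rewrite ltrDl.
Qed.

End EventualBounds.

(** Induction along the expansion into monomials. It serves twice: for tameness and for membership
    in [polynomial_in]. *)
Lemma meval_closed (R : realType) (T : Type) (n : nat) (f : 'I_n -> T -> R[i])
    (P : (T -> R[i]) -> Prop) :
  (forall c, P (fun=> c)) ->
  (forall u v, P u -> P v -> P (fun x => u x + v x)) ->
  (forall u v, P u -> P v -> P (fun x => u x * v x)) ->
  (forall i, P (f i)) -> forall Q, P (fun x => meval (f ^~ x) Q).
Proof.
move=> Pc PD PM Pf Q.
have -> : (fun x => meval (f ^~ x) Q) = (fun x =>
    \sum_(a <- msupp Q) mcoeff a Q * \prod_(i <- index_enum 'I_n) f i x ^+ a i).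
  by apply/funext => x; rewrite mevalE.
elim: (msupp Q : seq _) => [|a s IH].
  by under eq_fun do rewrite big_nil.
under eq_fun do rewrite big_cons; apply: (PD) => //; apply: (PM) => //.
elim: (index_enum _) => [|i t IHt].
  by under eq_fun do rewrite big_nil.
under eq_fun do rewrite big_cons; apply: (PM) => //.
elim: (a i) => [|k IHk]; first by under eq_fun do rewrite expr0.
by under eq_fun do rewrite exprS; apply: (PM).
Qed.

Section Manifold.
Variables (R : realType) (M : topologicalType) (m : nat).
Variable S : smooth_structure R M m.
Implicit Types (c : chart R M m) (u v : M -> R) (h : M -> R[i]).

Lemma chart_img_open c : open (chart_img c).
Proof. exact: open_chart_img. Qed.
Arguments chart_img_open : clear implicits.

Definition real_smooth u :=
  forall c, charts S c -> smooth_on (chart_img c) (u \o chart_inv c).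

Lemma smooth_ReIm h : (forall l, Cl S l h) <->
  real_smooth (fun p => complex.Re (h p)) /\ real_smooth (fun p => complex.Im (h p)).
Proof.
split=> [H|[Hr Hi] l c Sc]; last by split; [exact: Hr|exact: Hi].
by split=> c Sc l; have [] := H l c Sc.
Qed.

Lemma near_chart c p (Q : 'rV[R]_m -> Prop) : chart_dom c p ->
  (\forall y \near c p, Q y) -> \forall q \near p, chart_dom c q /\ Q (c q).
Proof.
move=> cp Qp.
have h1 : \forall q \near p, chart_dom c q.
  by apply: open_nbhs_nbhs; split => //; exact: open_chart_dom.
have h2 : \forall q \near p, Q (c q).
  by apply: (continuous_chart_map (c := c) (x := p)) Qp; rewrite inE.
by apply: filterS2 h1 h2.
Qed.

Lemma near_chart_jet s u c p : charts S c -> real_smooth u -> chart_dom c p ->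
  exists C, \forall q \near p, chart_dom c q /\
    bounded_jet s (u \o chart_inv c) (c q) C.
Proof.
move=> Sc Hu cp; have cW : chart_img c (c p) by exists p.
have [C HC] := near_bounded_jet (chart_img_open c) cW (Hu c Sc s).
exists C; exact: (@near_chart c p (fun y => bounded_jet s (u \o chart_inv c) y C)).
Qed.

Lemma real_smooth_bounded u : compact [set: M] -> real_smooth u ->
  exists C, forall p, `|u p| <= C.
Proof.
move=> cM Hu.
have [||C HC] := @compact_uniform_bound R M setT (fun C p => `|u p| <= C) cM.
- by move=> C D p CD uC; exact: le_trans CD.
- move=> p _; have [c Sc cp] := charts_cover S p.
  have [C HC] := near_chart_jet 0 Sc Hu cp; exists C.
  by apply: filterS HC => q [cq [/=]]; rewrite chart_mapK ?inE.
by exists C => p; exact: HC.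
Qed.

Section Tame.
Variables (n : nat) (f : 'I_n -> M -> R[i]).

Definition jets_le s c x (C : R) := forall i,
  bounded_jet s (fun y => complex.Re (f i (chart_inv c y))) x C /\
  bounded_jet s (fun y => complex.Im (f i (chart_inv c y))) x C.

(* D depends on s and C, but not on the chart or the point. *)
Definition tame u := real_smooth u /\
  forall s C, exists D, forall c x, charts S c -> chart_img c x ->
    jets_le s c x C -> bounded_jet s (u \o chart_inv c) x D.

Lemma tame_cst (a : R) : tame (fun=> a).
Proof.
split; first by move=> c Sc l; exact: Cl_on_cst.
by move=> s C; exists `|a| => c x _ _ _; exact: bounded_jet_cst.
Qed.

Lemma tameD u v : tame u -> tame v -> tame (fun p => u p + v p).
Proof.
move=> [su Du] [sv Dv]; split.
  by move=> c Sc l; apply: (Cl_onD (chart_img_open c)); [exact: su|exact: sv].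
move=> s C; have [[A HA] [B HB]] := (Du s C, Dv s C).
exists (A + B) => c x Sc cx H; apply: (bounded_jetD (chart_img_open c)) => //.
- exact: su.
- exact: sv.
- exact: HA.
- exact: HB.
Qed.

Lemma tameM u v : tame u -> tame v -> tame (fun p => u p * v p).
Proof.
move=> [su Du] [sv Dv]; split.
  by move=> c Sc l; apply: (Cl_onM (chart_img_open c)); [exact: su|exact: sv].
move=> s C; have [[A HA] [B HB]] := (Du s C, Dv s C).
exists (2 ^+ s * (A * B)) => c x Sc cx H; apply: (bounded_jetM (chart_img_open c)) => //.
- exact: su.
- exact: sv.
- exact: HA.
- exact: HB.
Qed.

(** Compactness bounds the inverse on all of [M] by one constant [B], independent of charts;
    together with the jet bound [A] it feeds [bounded_jetV]. *)
Lemma tameV u : compact [set: M] -> (forall p, u p != 0) -> tame u ->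
  tame (fun p => (u p)^-1).
Proof.
move=> cM u0 [su Du].
have sV : real_smooth (fun p => (u p)^-1).
  by move=> c Sc l; apply: (Cl_onV (chart_img_open c)) => //; exact: su.
split => // s C; have [A HA] := Du s C.
have [B HB] := real_smooth_bounded cM sV.
have [D HD] := @bounded_jetV R m s (Num.max A B).
exists D => c x Sc cx H; apply: (HD _ _ _ (chart_img_open c)) => //.
- exact: su.
- by apply: bounded_jet_le (HA c x Sc cx H); rewrite le_max lexx.
- by apply: (le_trans (HB _)); rewrite le_max lexx orbT.
Qed.

Definition complex_tame h :=
  tame (fun p => complex.Re (h p)) /\ tame (fun p => complex.Im (h p)).

Lemma complex_tame_smooth h : complex_tame h -> smooth S h.
Proof. by move=> [[hr _] [hi _]]; apply/smooth_ReIm. Qed.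

Lemma complex_tame_cst (a : R[i]) : complex_tame (fun=> a).
Proof. by split; exact: tame_cst. Qed.

Lemma complex_tameD h h' : complex_tame h -> complex_tame h' ->
  complex_tame (fun p => h p + h' p).
Proof.
move=> [hr hi] [h'r h'i]; split.
  rewrite (_ : (fun p => _) = fun p => complex.Re (h p) + complex.Re (h' p)).
    exact: tameD.
  by apply/funext => p; case: (h p) (h' p) => ? ? [].
rewrite (_ : (fun p => _) = fun p => complex.Im (h p) + complex.Im (h' p)).
  exact: tameD.
by apply/funext => p; case: (h p) (h' p) => ? ? [].
Qed.

Lemma complex_tameM h h' : complex_tame h -> complex_tame h' ->
  complex_tame (fun p => h p * h' p).
Proof.
move=> [hr hi] [h'r h'i]; split.
  rewrite (_ : (fun p => _) = fun p => complex.Re (h p) * complex.Re (h' p) +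
      -1 * (complex.Im (h p) * complex.Im (h' p))).
    by apply: tameD; [|apply: tameM; [exact: tame_cst|]]; exact: tameM.
  by apply/funext => p; rewrite mulN1r; case: (h p) (h' p) => ? ? [].
rewrite (_ : (fun p => _) = fun p => complex.Re (h p) * complex.Im (h' p) +
    complex.Im (h p) * complex.Re (h' p)).
  by apply: tameD; exact: tameM.
by apply/funext => p; case: (h p) (h' p) => ? ? [].
Qed.

Lemma complex_tameV h : compact [set: M] -> (forall p, h p != 0) ->
  complex_tame h -> complex_tame (fun p => (h p)^-1).
Proof.
move=> cM h0 [hr hi].
(* The inverse of [h] is its conjugate divided by [N], the squared modulus; this reduces to the real
   case. *)
pose N p := complex.Re (h p) * complex.Re (h p) + complex.Im (h p) * complex.Im (h p).
have tN : tame N by apply: tameD; exact: tameM.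
have N0 p : N p != 0.
  have := h0 p; rewrite /N; case: (h p) => a b /=.
  rewrite eq_complex /= -!expr2 => /nandP ab.
  by rewrite paddr_eq0 ?sqr_ge0 // !sqrf_eq0; apply/nandP.
have tV := tameV cM N0 tN.
split.
  rewrite (_ : (fun p => _) = fun p => complex.Re (h p) * (N p)^-1).
    exact: tameM.
  by apply/funext => p; rewrite /N -!expr2; case: (h p).
rewrite (_ : (fun p => _) = fun p => -1 * (complex.Im (h p) * (N p)^-1)).
  by apply: tameM; [exact: tame_cst|exact: tameM].
by apply/funext => p; rewrite /N -!expr2 mulN1r; case: (h p).
Qed.

Hypothesis f_smooth : forall i, smooth S (f i).

Lemma complex_tame_gen i : complex_tame (f i).
Proof.
have /smooth_ReIm[hr hi] := f_smooth i.
by split; split => // s C; exists C => c x _ _ /(_ i)[].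
Qed.

Lemma complex_tame_meval Q : complex_tame (fun p => meval (f ^~ p) Q).
Proof.
apply: meval_closed.
- exact: complex_tame_cst.
- exact: complex_tameD.
- exact: complex_tameM.
- exact: complex_tame_gen.
Qed.

End Tame.

(** * Uniform bounds over a finite atlas *)

Section Atlas.
Variables (r : nat) (B : 'I_r -> chart R M m).
Hypotheses (B_atlas : finite_atlas S B) (M_compact : compact [set: M]).

(** The closure of the small domain is compact and lies in the domain of a larger chart [c]. Jets
    are bounded there in the chart [c], and carry over because the two chart maps agree on the small
    domain. *)
Lemma atlas_jet_bound b s u : real_smooth u ->
  exists C, forall x, chart_img (B b) x -> bounded_jet s (u \o chart_inv (B b)) x C.
Proof.
move=> su; have [BS _ /(_ b)[c [Sc cl Bc]]] := B_atlas.
have cK : compact (closure (chart_dom (B b))).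
  by apply: subclosed_compact M_compact _ => //; exact: closed_closure.
have [||C HC] := @compact_uniform_bound R M _ (fun C p =>
    bounded_jet s (u \o chart_inv c) (c p) C) cK.
- by move=> C D p; exact: bounded_jet_le.
- move=> p /cl cp; have [C HC] := near_chart_jet s Sc su cp.
  by exists C; apply: filterS HC => q [].
exists C => x Bx.
apply: (@bounded_jet_eq _ _ _ s (u \o chart_inv c) _ x C (chart_img_open (B b)) Bx).
  move=> y /set_mem [q Bq <-] /=; congr u.
  have cq : chart_dom c q by apply: cl; exact: subset_closure.
  by rewrite (chart_mapK (mem_set Bq)) (Bc q (mem_set Bq)) (chart_mapK (mem_set cq)).
have [q Bq <-] := Bx; rewrite Bc ?inE //.
by apply: HC; exact: subset_closure.
Qed.

Lemma atlas_jets_le (n : nat) (f : 'I_n -> M -> R[i]) s :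
  (forall i, smooth S (f i)) ->
  exists C, forall b x, chart_img (B b) x -> jets_le f s (B b) x C.
Proof.
move=> f_smooth.
apply: finite_uniform_bound => [b C D CD H x Bx i|b].
  by have [h1 h2] := H x Bx i; split; exact: bounded_jet_le CD _.
have [|i|C HC] := @finite_uniform_bound R 'I_n (fun i C => forall x, chart_img (B b) x ->
  bounded_jet s (fun y => complex.Re (f i (chart_inv (B b) y))) x C /\
  bounded_jet s (fun y => complex.Im (f i (chart_inv (B b) y))) x C).
- move=> i C D CD H x Bx.
  by have [h1 h2] := H x Bx; split; exact: bounded_jet_le CD _.
- have /smooth_ReIm[hr hi] := f_smooth i.
  have [C1 H1] := atlas_jet_bound b s hr; have [C2 H2] := atlas_jet_bound b s hi.
  exists (Num.max C1 C2) => x Bx; split.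
    by apply: bounded_jet_le (H1 x Bx); rewrite le_max lexx.
  by apply: bounded_jet_le (H2 x Bx); rewrite le_max lexx orbT.
by exists C => x Bx i; exact: HC.
Qed.

End Atlas.

End Manifold.

Arguments chart_img_open {R M m} c.
(* The last inequality makes the tail after j small even relative to w j / B j. *)
Lemma rapidly_decreasing_weights (R : realType) (A B : nat -> R) :
  (forall j, 1 <= A j) -> (forall j, 1 <= B j) ->
  exists w : nat -> R, [/\ forall j, 0 < w j,
    forall j, w j * A j <= 2^-1 ^+ j &
    forall j i, (j < i)%N -> w i * A i * B j <= 2^-1 ^+ i * w j].
Proof.
move=> A1 B1.
have A0 j : 0 < A j by exact: lt_le_trans (A1 j).
have B0 j : 0 < B j by exact: lt_le_trans (B1 j).
(* As every factor is at least 1, this product dominates all [B j] with [j <= i] at once. *)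
pose PB i := \prod_(q < i.+1) B q.
have prod_ge1 i (P : pred 'I_i) : 1 <= \prod_(q < i | P q) B q.
  by elim/big_ind: _ => // x y; exact: mulr_ege1.
have PB1 i : 1 <= PB i by exact: prod_ge1.
have PB0 i : 0 < PB i by exact: lt_le_trans (PB1 i).
have PBj i j : (j <= i)%N -> B j <= PB i.
  move=> ji; rewrite /PB (bigD1 (inord j)) //= inordK ?ltnS //.
  by rewrite ler_peMr ?(ltW (B0 _)) ?prod_ge1.
pose d i := 2^-1 ^+ i / (A i * PB i).
have h0 i : 0 < 2^-1 ^+ i :> R by rewrite exprn_gt0 // invr_gt0.
have d0 i : 0 < d i by rewrite divr_gt0 // mulr_gt0.
have d1 i : d i <= 1.
  rewrite ler_pdivrMr ?mulr_gt0 // mul1r (le_trans (y := 1)) //.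
    by rewrite exprn_ile1 ?invr_ge0 // invf_le1 // ler1n.
  by rewrite -[X in X <= _]mul1r ler_pM.
(* The weights are products of the ratios [d], so a factor [w i] is still present in the next
   weight. This gives smallness relative to all earlier weights. *)
pose w i := \prod_(p < i.+1) d p.
have w0 i : 0 < w i by apply: prodr_gt0.
have wS i : w i.+1 = w i * d i.+1 by rewrite /w big_ord_recr.
have wmono j i : (j <= i)%N -> w i <= w j.
  elim: i => [|i IH]; first by rewrite leqn0 => /eqP ->.
  rewrite leq_eqVlt => /orP[/eqP -> //|/IH]; apply: le_trans.
  by rewrite wS ler_piMr // ltW.
have w1 i : w i <= d i.
  case: i => [|i]; first by rewrite /w big_ord1.
  rewrite wS ler_piMl ?(ltW (d0 _)) //; apply: le_trans (wmono 0%N i _) _ => //.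
  by rewrite /w big_ord1.
have dA i : d i * A i * PB i = 2^-1 ^+ i.
  by rewrite -mulrA divfK // gt_eqF // mulr_gt0.
clearbody w d PB; exists w; split => // [j|j i ji].
  rewrite -[leRHS]dA (le_trans (y := d j * A j)) ?ler_wpM2r ?(ltW (A0 _)) //.
  by rewrite ler_peMr // mulr_ge0 // ltW.
rewrite -dA; case: i ji => // i ji; rewrite wS.
have -> : w i * d i.+1 * A i.+1 * B j = d i.+1 * A i.+1 * (w i * B j) by ring.
(* After cancelling [d i.+1 * A i.+1] there remains [w i * B j <= PB i.+1 * w j], which follows from
   [wmono] and [PBj]. *)
rewrite -[leRHS]mulrA ler_wpM2l ?mulr_ge0 ?(ltW (d0 _)) ?(ltW (A0 _)) //.
rewrite [leRHS]mulrC.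
by apply: ler_pM; rewrite ?(ltW (w0 _)) ?(ltW (B0 _)) ?PBj ?wmono // ltnW.
Qed.

(** * Jets of complex-valued functions *)

Section ComplexJet.
Variables (R : realType) (m : nat).
Implicit Types (W : set 'rV[R]_m) (h : 'rV[R]_m -> R[i]) (x : 'rV[R]_m).

Definition complex_jet (s : nat) h x (C : R) :=
  bounded_jet s (fun y => complex.Re (h y)) x C /\
  bounded_jet s (fun y => complex.Im (h y)) x C.

Lemma complex_jet_le s h x C D : C <= D -> complex_jet s h x C ->
  complex_jet s h x D.
Proof. by move=> CD [h1 h2]; split; exact: bounded_jet_le CD _. Qed.

Lemma complex_jet_cst s (a : R[i]) x :
  complex_jet s (fun=> a) x (`|complex.Re a| + `|complex.Im a|).
Proof.
by split; apply: bounded_jet_le (bounded_jet_cst s _ x); rewrite ?lerDl ?lerDr.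
Qed.

Lemma Re_add (y z : R[i]) : complex.Re (y + z) = complex.Re y + complex.Re z.
Proof. by case: y z => ? ? []. Qed.

Lemma Im_add (y z : R[i]) : complex.Im (y + z) = complex.Im y + complex.Im z.
Proof. by case: y z => ? ? []. Qed.

Lemma Re_sum (I : Type) (t : seq I) (F : I -> R[i]) :
  complex.Re (\sum_(i <- t) F i) = \sum_(i <- t) complex.Re (F i).
Proof. by elim: t => [|i t IH]; rewrite ?big_nil // !big_cons Re_add IH. Qed.

Lemma Im_sum (I : Type) (t : seq I) (F : I -> R[i]) :
  complex.Im (\sum_(i <- t) F i) = \sum_(i <- t) complex.Im (F i).
Proof. by elim: t => [|i t IH]; rewrite ?big_nil // !big_cons Im_add IH. Qed.

Lemma Re_mul (y z : R[i]) : complex.Re (y * z) =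
  complex.Re y * complex.Re z + -1 * (complex.Im y * complex.Im z).
Proof. by rewrite mulN1r; case: y z => ? ? []. Qed.

Lemma Im_mul (y z : R[i]) : complex.Im (y * z) =
  complex.Re y * complex.Im z + complex.Im y * complex.Re z.
Proof. by case: y z => ? ? []. Qed.

Section Open.
Variable W : set 'rV[R]_m.
Hypothesis oW : open W.

Lemma complex_Cl_onM s h h' : complex_Cl_on s W h -> complex_Cl_on s W h' ->
  complex_Cl_on s W (fun y => h y * h' y).
Proof.
move=> [hr hi] [h'r h'i]; split.
  under eq_fun do rewrite Re_mul.
  apply: (Cl_onD oW); first exact: (Cl_onM oW).
  by apply: (Cl_onM oW); [exact: Cl_on_cst|exact: (Cl_onM oW)].
under eq_fun do rewrite Im_mul.
by apply: (Cl_onD oW); exact: (Cl_onM oW).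
Qed.

Lemma complex_jetD s h h' x A B : W x ->
  complex_Cl_on s W h -> complex_Cl_on s W h' ->
  complex_jet s h x A -> complex_jet s h' x B ->
  complex_jet s (fun y => h y + h' y) x (A + B).
Proof.
move=> Wx [hr hi] [h'r h'i] [hA1 hA2] [hB1 hB2]; split.
  under eq_fun do rewrite Re_add; exact: (bounded_jetD oW).
under eq_fun do rewrite Im_add; exact: (bounded_jetD oW).
Qed.

(** The real and imaginary parts of a product are each a sum of two real products, whence one more
    factor 2 than in the real case. *)
Lemma complex_jetM s h h' x A B : W x ->
  complex_Cl_on s W h -> complex_Cl_on s W h' ->
  complex_jet s h x A -> complex_jet s h' x B ->
  complex_jet s (fun y => h y * h' y) x (2 ^+ s.+1 * (A * B)).
Proof.
move=> Wx [hr hi] [h'r h'i] [hA1 hA2] [hB1 hB2].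
have -> : 2 ^+ s.+1 * (A * B) = 2 ^+ s * (A * B) + 2 ^+ s * (A * B) by rewrite exprS; ring.
split.
  under eq_fun do rewrite Re_mul.
  apply: (bounded_jetD oW) => //; first exact: (Cl_onM oW).
  - by apply: (Cl_onM oW); [exact: Cl_on_cst|exact: (Cl_onM oW)].
  - exact: (bounded_jetM oW).
  - rewrite -[X in bounded_jet _ _ _ X]mul1r -[X in X * _](normrN1 R).
    apply: (bounded_jetZ oW) => //; first exact: (Cl_onM oW).
    exact: (bounded_jetM oW).
under eq_fun do rewrite Im_mul.
apply: (bounded_jetD oW) => //; try exact: (Cl_onM oW); exact: (bounded_jetM oW).
Qed.

End Open.

(** As in [bounded_jetV], [D] is fixed before [h], so it can be chosen before a denominator is
    replaced by an approximation. The last hypothesis bounds the inverse of the squared modulus, by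
    which the conjugate of [h] is multiplied. *)
Lemma complex_jetV s (C : R) : exists D : R, forall W h x, open W -> W x ->
  (forall y, W y -> h y != 0) -> complex_Cl_on s W h ->
  complex_jet s h x C ->
  (complex.Re (h x) ^+ 2 + complex.Im (h x) ^+ 2)^-1 <= C ->
  complex_jet s (fun y => (h y)^-1) x D.
Proof.
(* This bounds the jet of the squared modulus. *)
pose C2 := 2 ^+ s * (C * C) + 2 ^+ s * (C * C).
have [D HD] := @bounded_jetV R m s (Num.max C C2).
exists (2 ^+ s * (C * D)) => W h x oW Wx h0 [hr hi] [hC1 hC2] NC.
pose N y := complex.Re (h y) * complex.Re (h y) + complex.Im (h y) * complex.Im (h y).
have N0 y : W y -> N y != 0.
  move=> /h0; rewrite /N; case: (h y) => a b /=.
  rewrite eq_complex /= -!expr2 => /nandP ab.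
  by rewrite paddr_eq0 ?sqr_ge0 // !sqrf_eq0; apply/nandP.
have CN : Cl_on s W N by apply: (Cl_onD oW); exact: (Cl_onM oW).
have CV := Cl_onV oW N0 CN.
have jV : bounded_jet s (fun y => (N y)^-1) x D.
  apply: (HD W) => //.
    apply: (@bounded_jet_le _ _ _ _ _ C2); first by rewrite le_max lexx orbT.
    apply: (bounded_jetD oW) => //; try exact: (Cl_onM oW); exact: (bounded_jetM oW).
  rewrite ger0_norm ?le_max; first by rewrite /N -!expr2 NC.
  by rewrite invr_ge0 addr_ge0 // -expr2 sqr_ge0.
have ReV y : complex.Re (h y)^-1 = complex.Re (h y) * (N y)^-1.
  by rewrite /N -!expr2; case: (h y).
have ImV y : complex.Im (h y)^-1 = -1 * (complex.Im (h y) * (N y)^-1).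
  by rewrite /N -!expr2 mulN1r; case: (h y).
split.
  by under eq_fun do rewrite ReV; exact: (bounded_jetM oW).
under eq_fun do rewrite ImV.
rewrite -[X in bounded_jet _ _ _ X]mul1r -[X in X * _](normrN1 R).
apply: (bounded_jetZ oW) => //; first exact: (Cl_onM oW).
exact: (bounded_jetM oW).
Qed.

End ComplexJet.

Section ClAlgebra.
Variables (R : realType) (M : topologicalType) (m : nat).
Variable S : smooth_structure R M m.
Implicit Types h : M -> R[i].

Lemma Cl_cst l a : Cl S l (fun=> a).
Proof. by move=> c Sc; split; exact: Cl_on_cst. Qed.

Lemma ClD l h h' : Cl S l h -> Cl S l h' -> Cl S l (fun p => h p + h' p).
Proof.
move=> Ch Ch' c Sc; apply: (complex_Cl_onD (chart_img_open c)).
  exact: Ch.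
exact: Ch'.
Qed.

Lemma ClM l h h' : Cl S l h -> Cl S l h' -> Cl S l (fun p => h p * h' p).
Proof.
move=> Ch Ch' c Sc; apply: (complex_Cl_onM (chart_img_open c)).
  exact: Ch.
exact: Ch'.
Qed.

Lemma ClB l h h' : Cl S l h -> Cl S l h' -> Cl S l (fun p => h p - h' p).
Proof.
move=> Ch Ch'; under eq_fun do rewrite -[X in _ + X]mulN1r.
by apply: ClD => //; apply: ClM => //; exact: Cl_cst.
Qed.

Lemma Cl_sum l (I : Type) (s : seq I) (h : I -> M -> R[i]) :
  (forall i, Cl S l (h i)) -> Cl S l (fun p => \sum_(i <- s) h i p).
Proof.
move=> Ch; elim: s => [|i s IH].
  by under eq_fun do rewrite big_nil; exact: Cl_cst.
by under eq_fun do rewrite big_cons; exact: ClD.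
Qed.

End ClAlgebra.

(** * Smoothness and tails of the weighted series *)

Section TameSeries.
Variables (R : realType) (M : topologicalType) (m : nat).
Variable S : smooth_structure R M m.
Variables (n : nat) (f : 'I_n -> M -> R[i]).
Hypothesis f_smooth : forall i, smooth S (f i).
Implicit Types (c : chart R M m).

Lemma jets_le_leq s t c x C D : (s <= t)%N -> C <= D ->
  jets_le f t c x C -> jets_le f s c x D.
Proof.
move=> st CD H i; have [h1 h2] := H i.
by split; apply: bounded_jet_le CD _; exact: bounded_jet_leq st _.
Qed.

(** A natural number as bound puts a whole neighbourhood of [x] within reach of [diagonal_bound] for
    all large indices. *)
Lemma near_jets_le s c x : charts S c -> chart_img c x ->
  exists j : nat, \forall y \near x, jets_le f s c y j%:R.
Proof.
move=> Sc cx.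
have /choice[D HD] : forall i, exists D : R, \forall y \near x,
    bounded_jet s (fun y => complex.Re (f i (chart_inv c y))) y D /\
    bounded_jet s (fun y => complex.Im (f i (chart_inv c y))) y D.
  move=> i.
  have /smooth_ReIm[hr hi] := f_smooth i.
  have [C1 H1] := near_bounded_jet (chart_img_open c) cx (hr c Sc s).
  have [C2 H2] := near_bounded_jet (chart_img_open c) cx (hi c Sc s).
  exists (Num.max C1 C2); apply: filterS2 H1 H2 => y h1 h2; split.
    by apply: bounded_jet_le h1; rewrite le_max lexx.
  by apply: bounded_jet_le h2; rewrite le_max lexx orbT.
pose C := \big[Num.max/0]_i D i.
have C0 : 0 <= C by exact: bigmax_ge_id.
exists (Num.bound C).
have : \forall y \near x, forall i,
    bounded_jet s (fun y => complex.Re (f i (chart_inv c y))) y (D i) /\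
    bounded_jet s (fun y => complex.Im (f i (chart_inv c y))) y (D i).
  by apply: (@filter_forall _ _ _ (nbhs x)) => i; exact: HD.
apply: filterS => y H i; have [h1 h2] := H i.
have DC : D i <= (Num.bound C)%:R.
  by apply: (le_trans (le_bigmax _ _ i)); apply: ltW; exact: archi_boundP.
by split; exact: bounded_jet_le DC _.
Qed.

(* Both the order and the bound on the jets of f may grow with j: for every chart
   and every point this eventually applies. *)
Definition diagonal_bound (v : M -> R) (j : nat) (D : R) :=
  forall s c x, (s <= j)%N -> charts S c -> chart_img c x ->
    jets_le f s c x j%:R -> bounded_jet s (v \o chart_inv c) x D.

Lemma diagonal_bound_le v j D E : D <= E -> diagonal_bound v j D ->
  diagonal_bound v j E.
Proof. by move=> DE H s c x sj Sc cx /(H s c x sj Sc cx); exact: bounded_jet_le. Qed.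

(** For fixed [j] only the finitely many orders [s <= j] and the single jet bound [j] occur. *)
Lemma tame_diagonal_bound v j : tame S f v -> exists D, diagonal_bound v j D.
Proof.
move=> [_ tv].
have [|s|D HD] := @finite_uniform_bound R 'I_j.+1 (fun s D => forall c x, charts S c ->
  chart_img c x -> jets_le f s c x j%:R -> bounded_jet s (v \o chart_inv c) x D).
- by move=> s C D CD H c x Sc cx /(H c x Sc cx); exact: bounded_jet_le.
- exact: tv.
- by exists D => s c x sj; exact: (HD (Ordinal (sj : (s < j.+1)%N))).
Qed.

Section Sum.
Variables (v : nat -> M -> R) (A B w : nat -> R).
Hypotheses (v_smooth : forall j, real_smooth S (v j))
  (v_bound : forall j, diagonal_bound (v j) j (A j))
  (w_gt0 : forall j, 0 < w j) (B_ge1 : forall j, 1 <= B j)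
  (w_A : forall j, w j * A j <= 2^-1 ^+ j)
  (w_AB : forall j i, (j < i)%N -> w i * A i * B j <= 2^-1 ^+ i * w j).

Definition weighted_sum p := limn (series (fun j => w j * v j p)).

Let term c j : 'rV[R]_m -> R := fun y => w j * v j (chart_inv c y).

Let term_smooth c j : charts S c -> smooth_on (chart_img c) (term c j).
Proof.
move=> Sc l; apply: (Cl_onM (chart_img_open c)); first exact: Cl_on_cst.
exact: v_smooth.
Qed.

Let term_jet c j s x : charts S c -> chart_img c x -> (s <= j)%N ->
  jets_le f s c x j%:R -> bounded_jet s (term c j) x (w j * A j).
Proof.
move=> Sc cx sj H; rewrite -[w j in X in bounded_jet _ _ _ X]ger0_norm ?(ltW (w_gt0 j)) //.
apply: (bounded_jetZ (chart_img_open c)) => //; first exact: v_smooth.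
exact: v_bound.
Qed.

Let term_summable c : charts S c -> jet_summable (chart_img c) (term c).
Proof.
move=> Sc s x cx; have [j Hj] := near_jets_le s Sc cx.
(* Beyond this index both the order and the jet bound of [f] near [x] fall under the diagonal. *)
exists (maxn s j).
have : \forall y \near x, chart_img c y.
  by apply: open_nbhs_nbhs; split => //; exact: chart_img_open.
apply: filterS2 Hj => y Hy cy i; rewrite geq_max => /andP[si ji].
apply: bounded_jet_le (w_A i) _; apply: term_jet => //.
by apply: jets_le_leq Hy => //; rewrite ler_nat.
Qed.

Lemma weighted_sum_smooth : real_smooth S weighted_sum.
Proof.
move=> c Sc l; apply: (@series_sum_Cl_on R m (chart_img c) (term c)).
- exact: chart_img_open.
- by move=> j; exact: term_smooth.
- exact: term_summable.
Qed.

(** By [w_AB] the [i]-th term, for [i > j], is at most [2^-1 ^+ i * w j / B j], and these sum to the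
    stated bound. It remains small after division by [w j] and multiplication by a function with
    jets at most [B j]. *)
Lemma weighted_sum_tail s c x j : charts S c -> chart_img c x -> (s <= j)%N ->
  jets_le f s c x j%:R ->
  bounded_jet s ((fun p => weighted_sum p - \sum_(i < j.+1) w i * v i p) \o chart_inv c)
    x (2^-1 ^+ j * w j / B j).
Proof.
move=> Sc cx sj fx.
(* The tail is padded with zeros to a full series, which keeps the indices of the terms
   unchanged. *)
pose t i : 'rV[R]_m -> R := if (i < j.+1)%N then (fun=> 0) else term c i.
have t_summable : jet_summable (chart_img c) t.
  move=> s' x' cx'; have [N HN] := term_summable Sc s' cx'.
  exists (maxn N j.+1); apply: filterS HN => y Hy i; rewrite geq_max => /andP[Ni ji].
  by rewrite /t ltnNge ji; exact: Hy.
have t_smooth i : smooth_on (chart_img c) (t i).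
  by rewrite /t; case: ifP => _ l; [exact: Cl_on_cst|exact: term_smooth].
pose b i := if (i < j.+1)%N then 0 else w i * A i.
have B0 : 0 < B j by exact: lt_le_trans (B_ge1 j).
have bb k : series b k <= 2^-1 ^+ j * w j / B j.
  have h i : b i <= if (i < j.+1)%N then 0 else 2^-1 ^+ i * (w j / B j).
    rewrite /b; case: ltnP => // ji; rewrite mulrA ler_pdivlMr //.
    exact: w_AB.
  rewrite /series /= (le_trans (ler_sum _ (fun i _ => h i))) //.
  have [kj|jk] := leqP k j.+1.
    rewrite big_nat big1 => [|i /andP[_ ik]].
      by rewrite !mulr_ge0 ?invr_ge0 ?exprn_ge0 ?invr_ge0 // ltW.
    by rewrite (leq_trans ik kj).
  rewrite (big_cat_nat (n := j.+1)) //=; last exact: ltnW.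
  rewrite big_nat big1 ?add0r => [|i /andP[_ ij]]; last by rewrite ij.
  rewrite big_nat (eq_bigr (fun i => 2^-1 ^+ i * (w j / B j))); last first.
    by move=> i /andP[ji _]; rewrite ltnNge ji.
  rewrite -big_nat -mulr_suml -mulrA ler_wpM2r ?divr_ge0 ?(ltW (w_gt0 j)) ?(ltW B0) //.
  (* The sum starts at [j.+1], so the factor 2 of [sum_half_pow] is absorbed and [2^-1 ^+ j]
     remains. *)
  by apply: (le_trans (sum_half_pow _ _ _)); rewrite exprS mulrA divff // mul1r.
have tb i : bounded_jet s (t i) x (b i).
  rewrite /t /b; case: ltnP => ji.
    by rewrite -[X in bounded_jet _ _ _ X](normr0 R); exact: bounded_jet_cst.
  apply: term_jet => //; first exact: leq_trans sj (ltnW ji).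
  by apply: jets_le_leq fx => //; rewrite ler_nat ltnW.
have := series_sum_bounded_jet (chart_img_open c) cx t_smooth t_summable tb bb.
apply: bounded_jet_eq (chart_img_open c) cx _.
move=> y /set_mem cy /=.
have cv := jet_summable_cvg (term_summable Sc) cy.
have ct := jet_summable_cvg t_summable cy.
(* Shifting by [j.+1] makes the initial block split off for every [k], so the identity passes to the
   limit. *)
have E : (fun k => series (t ^~ y) (k + j.+1)%N + \sum_(i < j.+1) term c i y) =
    (fun k => series (fun i => term c i y) (k + j.+1)%N).
  apply/funext => k; rewrite /series /= (big_cat_nat (n := j.+1)) //= ?leq_addl //.
  rewrite [RHS](big_cat_nat (n := j.+1)) //= ?leq_addl //.
  rewrite [X in X + _ + _]big_nat big1 ?add0r => [|i /andP[_ ij]]; last by rewrite /t ij.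
  rewrite addrC big_mkord; congr (_ + _).
  rewrite big_nat [RHS]big_nat; apply: eq_bigr => i /andP[ji _].
  by rewrite /t ltnNge ji.
apply/esym/eqP; rewrite subr_eq; apply/eqP.
have c1 : series (fun i => term c i y) (k + j.+1)%N @[k --> \oo] --> weighted_sum (chart_inv c y).
  by have := cv; rewrite -(cvg_shiftn j.+1).
have c2 : series (t ^~ y) (k + j.+1)%N @[k --> \oo] --> series_sum t y.
  by have := ct; rewrite -(cvg_shiftn j.+1).
have c3 : series (t ^~ y) (k + j.+1)%N + \sum_(i < j.+1) term c i y @[k --> \oo] -->
    series_sum t y + \sum_(i < j.+1) term c i y.
  by apply: cvgD => //; exact: cvg_cst.
rewrite -E in c1; rewrite -(cvg_lim (@norm_hausdorff _ _) c1).
exact: (cvg_lim (@norm_hausdorff _ _) c3).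
Qed.

End Sum.

End TameSeries.
(** * The additional generator *)

Section PolynomialIn.
Variables (R : realType) (M : topologicalType) (n : nat) (f : 'I_n -> M -> R[i]).

Lemma polynomial_in_cst a : polynomial_in f (fun=> a).
Proof. by exists (mpolyC n a); apply/funext => x; rewrite mevalC. Qed.

Lemma polynomial_inD u v : polynomial_in f u -> polynomial_in f v ->
  polynomial_in f (fun x => u x + v x).
Proof.
by move=> [P ->] [Q ->]; exists (P + Q); apply/funext => x; rewrite mevalD.
Qed.

Lemma polynomial_inM u v : polynomial_in f u -> polynomial_in f v ->
  polynomial_in f (fun x => u x * v x).
Proof.
by move=> [P ->] [Q ->]; exists (P * Q); apply/funext => x; rewrite mevalM.
Qed.

Lemma polynomial_in_gen i : polynomial_in f (f i).
Proof. by exists (mpolyX _ (mnm1 i)); apply/funext => x; rewrite mevalXU. Qed.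

Lemma polynomial_in_sum (I : Type) (s : seq I) (u : I -> M -> R[i]) :
  (forall i, polynomial_in f (u i)) -> polynomial_in f (fun x => \sum_(i <- s) u i x).
Proof.
move=> H; elim: s => [|i s IH].
  by under eq_fun do rewrite big_nil; exact: polynomial_in_cst.
by under eq_fun do rewrite big_cons; exact: polynomial_inD.
Qed.

End PolynomialIn.

Section Adjoin.
Variables (R : realType) (M : topologicalType) (n : nat) (f : 'I_n -> M -> R[i]).
Variable g : M -> R[i].

Lemma family_rcons_max : family_rcons f g ord_max = g.
Proof. by rewrite /family_rcons unlift_none. Qed.

Lemma family_rcons_lift i : family_rcons f g (lift ord_max i) = f i.
Proof. by rewrite /family_rcons liftK. Qed.

Lemma polynomial_in_adjoin Q :
  polynomial_in (family_rcons f g) (fun x => meval (f ^~ x) Q).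
Proof.
apply: meval_closed.
- exact: polynomial_in_cst.
- exact: polynomial_inD.
- exact: polynomial_inM.
- by move=> i; rewrite -family_rcons_lift; exact: polynomial_in_gen.
Qed.

Lemma polynomial_in_adjoined : polynomial_in (family_rcons f g) g.
Proof. by rewrite -[X in polynomial_in _ X]family_rcons_max; exact: polynomial_in_gen. Qed.

End Adjoin.

Section Generator.
Variables (R : realType) (M : topologicalType) (m : nat).
Variable S : smooth_structure R M m.
Hypothesis M_compact : compact [set: M].
Variables (n : nat) (f : 'I_n -> M -> R[i]).
Hypothesis f_smooth : forall i, smooth S (f i).
Variable q : nat -> mpoly n R[i].
Hypothesis q_neq0 : forall j p, meval (f ^~ p) (q j) != 0.

Let F Q p := meval (f ^~ p) Q.
Let d j := \prod_(0 <= i < j) q i.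

Let d_neq0 j p : F (d j) p != 0.
Proof.
rewrite /F /d rmorph_prod; elim/big_ind: _ => [|x y|i _].
- exact: oner_neq0.
- exact: mulf_neq0.
- exact: q_neq0.
Qed.

(** With this shift [F (d j)] times [h j] is the inverse of [F (q j)], while [F (d j)] times [h i]
    is a polynomial in [f] for [i < j]. *)
Let h j p := (F (d j.+1) p)^-1.

Let d_tame j : complex_tame S f (F (d j)).
Proof. exact: complex_tame_meval. Qed.

Let h_tame j : complex_tame S f (h j).
Proof. by apply: complex_tameV => // p; exact: d_neq0. Qed.

Lemma complex_diagonal_bound u j : complex_tame S f u -> exists D,
  [/\ 1 <= D, diagonal_bound S f (fun p => complex.Re (u p)) j D &
      diagonal_bound S f (fun p => complex.Im (u p)) j D].
Proof.
move=> [ur ui]; have [C1 H1] := tame_diagonal_bound j ur.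
have [C2 H2] := tame_diagonal_bound j ui.
exists (Num.max 1 (Num.max C1 C2)); split; first by rewrite le_max lexx.
  by apply: diagonal_bound_le H1; rewrite !le_max lexx !orbT.
by apply: diagonal_bound_le H2; rewrite !le_max lexx !orbT.
Qed.

(** The threshold [N] depends on the order, the jet bound and the accuracy, but not on which
    polynomial [q j] is. A polynomial that recurs in the sequence is therefore served to any
    accuracy by a late occurrence. *)
Lemma reciprocals_generator : exists g : M -> R[i], smooth S g /\
  forall s (C e : R), 0 < e -> exists N, forall j, (N <= j)%N ->
  exists2 A, polynomial_in (family_rcons f g) A &
    forall c x, charts S c -> chart_img c x -> jets_le f s c x C ->
      complex_jet s (fun y => (F (q j) (chart_inv c y))^-1 - A (chart_inv c y)) x e.
Proof.
have [A HA] := choice (fun j => complex_diagonal_bound j (h_tame j)).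
have [B HB] := choice (fun j => complex_diagonal_bound j (d_tame j)).
have A1 j : 1 <= A j by have [] := HA j.
have B1 j : 1 <= B j by have [] := HB j.
have [w [w0 wA wAB]] := rapidly_decreasing_weights A1 B1.
have hA_Re j : diagonal_bound S f (fun p => complex.Re (h j p)) j (A j) by have [] := HA j.
have hA_Im j : diagonal_bound S f (fun p => complex.Im (h j p)) j (A j) by have [] := HA j.
have h_Re j : real_smooth S (fun p => complex.Re (h j p)) by have [[]] := h_tame j.
have h_Im j : real_smooth S (fun p => complex.Im (h j p)) by have [_ []] := h_tame j.
pose g p := weighted_sum (fun j p => complex.Re (h j p)) w p +i*
            weighted_sum (fun j p => complex.Im (h j p)) w p.
have g_smooth : smooth S g.
  apply/smooth_ReIm; split.
    exact: (weighted_sum_smooth f_smooth h_Re hA_Re w0 wA).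
  exact: (weighted_sum_smooth f_smooth h_Im hA_Im w0 wA).
exists g; split => // s C e e0.
(* One factor for each of the two products below: with [F (d j)] and with the inverse weight. *)
pose K : R := 2 ^+ s.+1 * 2 ^+ s.+1.
have K0 : 0 < K by rewrite mulr_gt0 // exprn_gt0.
have [n0 Hn0] := half_pow_small (divr_gt0 e0 K0).
exists (maxn s (maxn (Num.bound `|C|) n0)) => j.
rewrite !geq_max => /and3P[sj Cj nj].
(* The quotient of [d j] by [d i.+1], as a polynomial. *)
pose G i := \prod_(i.+1 <= k < j) q k.
(* Multiply [g] by [F (d j)], remove the terms [i < j], which have become polynomials, and divide by
   [w j]: the term [j] turns into the inverse of [F (q j)]. *)
pose P p := (w j)^-1%:C * (F (d j) p * g p + -1 * \sum_(i < j) (w i)%:C * F (G i) p).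
exists P.
  apply: polynomial_inM; first exact: polynomial_in_cst.
  apply: polynomial_inD.
    by apply: polynomial_inM; [exact: polynomial_in_adjoin|exact: polynomial_in_adjoined].
  apply: polynomial_inM; first exact: polynomial_in_cst.
  apply: polynomial_in_sum => i.
  by apply: polynomial_inM; [exact: polynomial_in_cst|exact: polynomial_in_adjoin].
move=> c x Sc cx fx.
have fxj : jets_le f s c x j%:R.
  apply: jets_le_leq fx => //; apply: (le_trans (ler_norm C)).
  by apply: (le_trans (ltW (archi_boundP (normr_ge0 C)))); rewrite ler_nat.
(* The tail of [g] after [j]; up to the factor [F (d j)] and the inverse weight it is the whole
   error, as [E] shows. *)
pose T p := g p + -1 * \sum_(i < j.+1) (w i)%:C * h i p.
have ReT p : complex.Re (T p) = weighted_sum (fun j p => complex.Re (h j p)) w p -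
    \sum_(i < j.+1) w i * complex.Re (h i p).
  rewrite /T Re_add /=; congr (_ + _); rewrite mulN1r -!sumrN Re_sum.
  by apply: eq_bigr => i _; case: (h i p) => a b /=; rewrite mul0r subr0.
have ImT p : complex.Im (T p) = weighted_sum (fun j p => complex.Im (h j p)) w p -
    \sum_(i < j.+1) w i * complex.Im (h i p).
  rewrite /T Im_add /=; congr (_ + _); rewrite mulN1r -!sumrN Im_sum.
  by apply: eq_bigr => i _; case: (h i p) => a b /=; rewrite mul0r addr0.
have T_smooth : smooth S T.
  move=> l; apply: ClD; first exact: g_smooth.
  apply: ClM; first exact: Cl_cst.
  apply: Cl_sum => i; apply: ClM; first exact: Cl_cst.
  exact: complex_tame_smooth (h_tame _) _.
have wj0 : (w j)%:C != 0 by rewrite eq_complex /= gt_eqF.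
have E p : (F (q j) p)^-1 - P p = (- (w j)^-1)%:C * (F (d j) p * T p).
  have dS i : (i < j)%N -> F (d j) p = F (d i.+1) p * F (G i) p.
    by move=> ij; rewrite /F /d (big_cat_nat (n := i.+1)) //= rmorphM.
  rewrite /P /T big_ord_recr /=.
  have -> : \sum_(i < j) (w i)%:C * h i p = (F (d j) p)^-1 * \sum_(i < j) (w i)%:C * F (G i) p.
    rewrite mulr_sumr; apply: eq_bigr => i _; rewrite /h (dS i) // invfM.
    have G0 : F (G i) p != 0.
      by have := d_neq0 j p; rewrite (dS i) // mulf_eq0 => /norP[].
    by rewrite mulrCA -mulrA mulVf ?mulr1.
  have -> : h j p = (F (d j) p)^-1 * (F (q j) p)^-1.
    by rewrite /h /F /d big_nat_recr //= rmorphM invfM.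
  rewrite rmorphN fmorphV; set X := \sum_(i < j) _.
  have := d_neq0 j p; have := q_neq0 j p; rewrite -/(F (q j) p).
  by move: (F (q j) p) (F (d j) p) (g p) X => Q D y X Q0 D0; field; rewrite wj0 Q0 D0.
under eq_fun do rewrite E.
pose tau : R := 2^-1 ^+ j * w j / B j.
have dB_Re : diagonal_bound S f (fun p => complex.Re (F (d j) p)) j (B j) by have [] := HB j.
have dB_Im : diagonal_bound S f (fun p => complex.Im (F (d j) p)) j (B j) by have [] := HB j.
have jT : complex_jet s (fun y => T (chart_inv c y)) x tau.
  split.
    under eq_fun do rewrite ReT.
    exact: (weighted_sum_tail f_smooth h_Re hA_Re w0 B1 wA wAB Sc cx sj fxj).
  under eq_fun do rewrite ImT.
  exact: (weighted_sum_tail f_smooth h_Im hA_Im w0 B1 wA wAB Sc cx sj fxj).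
have jD : complex_jet s (fun y => F (d j) (chart_inv c y)) x (B j).
  by split; [exact: dB_Re|exact: dB_Im].
have CD : complex_Cl_on s (chart_img c) (fun y => F (d j) (chart_inv c y)).
  exact: (complex_tame_smooth (d_tame j) s Sc).
have CT : complex_Cl_on s (chart_img c) (fun y => T (chart_inv c y)).
  exact: (T_smooth s c Sc).
have oW := chart_img_open c.
have jDT := complex_jetM oW cx CD CT jD jT.
have CDT := complex_Cl_onM oW CD CT.
have Cc : complex_Cl_on s (chart_img c) (fun=> (- (w j)^-1)%:C) by split; exact: Cl_on_cst.
have := complex_jetM oW cx Cc CDT (complex_jet_cst s _ x) jDT.
apply: complex_jet_le; rewrite /= normr0 addr0 normrN gtr0_norm ?invr_gt0 //.
have Bj0 : B j != 0 by rewrite gt_eqF // (lt_le_trans _ (B1 j)).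
have wj : w j != 0 by rewrite gt_eqF.
(* The factors [w j] and [B j] in [tau] cancel those of the inverse weight and of [F (d j)]. *)
have -> : 2 ^+ s.+1 * ((w j)^-1 * (2 ^+ s.+1 * (B j * tau))) = 2^-1 ^+ j * K.
  by rewrite /tau /K; move: (2^-1 ^+ j) (2 ^+ s.+1) => y z; field; rewrite Bj0 wj.
by rewrite -ler_pdivlMr // Hn0.
Qed.

End Generator.
(** * Density *)

Lemma injective_unbounded (u : nat -> nat) : injective u ->
  forall N, exists k, (N <= u k)%N.
Proof.
move=> u_inj N; apply: contrapT => /forallNP H.
have uN (i : 'I_N.+1) : (u i < N)%N by rewrite ltnNge; apply/negP; exact: H.
have /leq_card : injective (fun i : 'I_N.+1 => Ordinal (uN i)).
  by move=> i j [/u_inj /val_inj].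
by rewrite !card_ord ltnn.
Qed.

Lemma rat_approx (R : realType) (x e : R) : 0 < e -> exists q : rat, `|x - ratr q| <= e.
Proof.
move=> e0; have [|q] := @rat_in_itvoo R (x - e) (x + e).
  by rewrite ltrBlDr -addrA ltrDl addr_gt0.
rewrite in_itv /= => /andP[h1 h2]; exists q.
by rewrite ler_norml; apply/andP; split; lra.
Qed.

Section AtlasJet.
Variables (R : realType) (M : topologicalType) (m : nat).
Variable S : smooth_structure R M m.
Hypothesis M_compact : compact [set: M].
Variables (r : nat) (B : 'I_r -> chart R M m) (l : nat).
Hypothesis B_atlas : finite_atlas S B.
Implicit Types h : M -> R[i].

Let BS b : charts S (B b). Proof. by have [] := B_atlas. Qed.

(** A real-valued substitute for the norm that is compatible with products and inverses;
    [Cl_norm_le] turns it into a bound on the norm. *)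
Definition atlas_jet h (C : R) := forall b x, chart_img (B b) x ->
  complex_jet l (fun y => h (chart_inv (B b) y)) x C.

Lemma atlas_jet_le h C D : C <= D -> atlas_jet h C -> atlas_jet h D.
Proof. by move=> CD H b x Bx; exact: complex_jet_le CD (H b x Bx). Qed.

Lemma atlas_jetD h h' C D : Cl S l h -> Cl S l h' -> atlas_jet h C ->
  atlas_jet h' D -> atlas_jet (fun p => h p + h' p) (C + D).
Proof.
move=> Ch Ch' H H' b x Bx; apply: (complex_jetD (chart_img_open (B b))) => //.
- exact: Ch.
- exact: Ch'.
- exact: H.
- exact: H'.
Qed.

Lemma atlas_jetM h h' C D : Cl S l h -> Cl S l h' -> atlas_jet h C ->
  atlas_jet h' D -> atlas_jet (fun p => h p * h' p) (2 ^+ l.+1 * (C * D)).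
Proof.
move=> Ch Ch' H H' b x Bx; apply: (complex_jetM (chart_img_open (B b))) => //.
- exact: Ch.
- exact: Ch'.
- exact: H.
- exact: H'.
Qed.

Lemma atlas_jet_cst a : atlas_jet (fun=> a) (`|complex.Re a| + `|complex.Im a|).
Proof. by move=> b x _; exact: complex_jet_cst. Qed.

Lemma atlas_jet_point h C p : atlas_jet h C ->
  `|complex.Re (h p)| <= C /\ `|complex.Im (h p)| <= C.
Proof.
move=> H; have [_ /(_ p)[b bp] _] := B_atlas.
have [|h1 h2] := H b (B b p); first by exists p.
move: (bounded_jet0 h1) (bounded_jet0 h2).
by rewrite (chart_mapK (mem_set bp)).
Qed.

Lemma smooth_atlas_jet h : smooth S h -> exists2 C, 1 <= C & atlas_jet h C.
Proof.
move=> /smooth_ReIm[hr hi].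
suff [C HC] : exists C, forall b x, chart_img (B b) x ->
    complex_jet l (fun y => h (chart_inv (B b) y)) x C.
  by exists (Num.max 1 C); rewrite ?le_max ?lexx //; apply: atlas_jet_le HC;
    rewrite le_max lexx orbT.
apply: finite_uniform_bound => [b C D CD H x Bx|b].
  exact: complex_jet_le CD (H x Bx).
have [C1 H1] := atlas_jet_bound B_atlas M_compact b l hr.
have [C2 H2] := atlas_jet_bound B_atlas M_compact b l hi.
exists (Num.max C1 C2) => x Bx; split.
  by apply: bounded_jet_le (H1 x Bx); rewrite le_max lexx.
by apply: bounded_jet_le (H2 x Bx); rewrite le_max lexx orbT.
Qed.

Lemma atlas_jetV C : exists D, forall h, (forall p, h p != 0) -> Cl S l h ->
  atlas_jet h C ->
  (forall p, (complex.Re (h p) ^+ 2 + complex.Im (h p) ^+ 2)^-1 <= C) ->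
  atlas_jet (fun p => (h p)^-1) D.
Proof.
have [D HD] := @complex_jetV R m l C; exists D => h h0 Ch hC NC b x Bx.
apply: (HD (chart_img (B b)) (fun y => h (chart_inv (B b) y)) x) => //.
- exact: chart_img_open.
- exact: Ch.
- exact: hC.
Qed.

Lemma Cl_norm_le h C : 0 <= C -> atlas_jet h C ->
  (Cl_norm B l h <= (r%:R * (#|{: bmultinom m l.+1}|%:R * (C + C)))%:E)%E.
Proof.
move=> C0 H; rewrite /Cl_norm.
have -> : (r%:R * (#|{: bmultinom m l.+1}|%:R * (C + C)))%:E =
    (\sum_(b < r) (#|{: bmultinom m l.+1}|%:R * (C + C))%:E)%E.
  by rewrite sumEFin sumr_const card_ord mulr_natl.
by apply: lee_sum => b _; apply: Cl_norm_on_le => // x Bx; exact: H.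
Qed.

Lemma Cl_normD h h' : Cl S l h -> Cl S l h' ->
  (Cl_norm B l (fun p => h p + h' p)%R <= Cl_norm B l h + Cl_norm B l h')%E.
Proof.
move=> Ch Ch'; rewrite /Cl_norm -big_split /=; apply: lee_sum => b _.
apply: Cl_norm_onD; first exact: chart_img_open.
  exact: Ch.
exact: Ch'.
Qed.

(** * Approximation by polynomials with rational coefficients *)

Section RationalCoefficients.
Variables (n : nat) (f : 'I_n -> M -> R[i]).
Hypothesis f_smooth : forall i, smooth S (f i).

Let F Q p := meval (f ^~ p) Q.
Let F_smooth Q : smooth S (F Q).
Proof. exact: complex_tame_smooth (complex_tame_meval f_smooth Q). Qed.

(** Lists of exponents with pairs of rationals form a countable type, so these polynomials can be
    enumerated. *)
Definition rational_mpoly (t : seq (multinom n * (rat * rat))) : mpoly n R[i] :=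
  \sum_(a <- t) mpolyC n (ratr a.2.1 +i* ratr a.2.2) * mpolyX _ a.1.

Lemma rational_mpoly_dense Q e : 0 < e ->
  exists t, atlas_jet (fun p => F (rational_mpoly t) p - F Q p) e.
Proof.
move=> e0.
(* The monomials are treated one at a time; the tolerance is general because each step spends half
   of it on the new coefficient. *)
suff H (s : seq (multinom n)) d : 0 < d -> exists t,
    atlas_jet (fun p => F (rational_mpoly t) p -
      F (\sum_(a <- s) mpolyC n (mcoeff a Q) * mpolyX _ a) p) d.
  have [t Ht] := H (msupp Q) e e0; exists t.
  have EQ : \sum_(a <- msupp Q) mpolyC n (mcoeff a Q) * mpolyX _ a = Q.
    by rewrite [RHS]mpolyE; apply: eq_bigr => a _; rewrite mul_mpolyC.
  by rewrite EQ in Ht.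
elim: s d => [|a s IH] d d0.
  exists [::] => b x Bx; rewrite /rational_mpoly !big_nil.
  under eq_fun do rewrite subrr.
  apply: complex_jet_le (complex_jet_cst l 0 x).
  by rewrite /= normr0 addr0 ltW.
have d2 : 0 < d / 2 by rewrite divr_gt0.
have [t Ht] := IH _ d2.
have [K K1 HK] := smooth_atlas_jet (F_smooth (mpolyX _ a)).
have K0 : 0 < K by exact: lt_le_trans K1.
(* An error [eta] in both parts of the coefficient contributes exactly [d / 2] after the product
   rule with the monomial. *)
pose eta := d / 2 / (2 ^+ l.+1 * (2 * K)).
have c0 : 0 < 2 ^+ l.+1 * (2 * K) by rewrite mulr_gt0 ?exprn_gt0 // mulr_gt0.
have eta0 : 0 < eta by rewrite divr_gt0.
have [x Hx] := rat_approx (complex.Re (mcoeff a Q)) eta0.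
have [y Hy] := rat_approx (complex.Im (mcoeff a Q)) eta0.
exists ((a, (x, y)) :: t).
pose z : R[i] := (ratr x +i* ratr y) - mcoeff a Q.
have E p : F (rational_mpoly ((a, (x, y)) :: t)) p -
    F (\sum_(b <- a :: s) mpolyC n (mcoeff b Q) * mpolyX _ b) p =
  z * F (mpolyX _ a) p + (F (rational_mpoly t) p -
    F (\sum_(b <- s) mpolyC n (mcoeff b Q) * mpolyX _ b) p).
  rewrite /rational_mpoly !big_cons /F !mevalD !mevalM !mevalC /z /=.
  by ring.
have hz : atlas_jet (fun=> z) (2 * eta).
  apply: atlas_jet_le (atlas_jet_cst z).
  have -> : complex.Re z = ratr x - complex.Re (mcoeff a Q) by rewrite /z; case: (mcoeff a Q).
  have -> : complex.Im z = ratr y - complex.Im (mcoeff a Q) by rewrite /z; case: (mcoeff a Q).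
  by rewrite mulr_natl mulr2n lerD // distrC.
have Cz : Cl S l (fun=> z) by exact: Cl_cst.
have h1 := atlas_jetM Cz (F_smooth (mpolyX _ a) l) hz HK.
have C1 := ClM Cz (F_smooth (mpolyX _ a) l).
have C2 := ClB (F_smooth (rational_mpoly t) l)
  (F_smooth (\sum_(b <- s) mpolyC n (mcoeff b Q) * mpolyX _ b) l).
have := atlas_jetD C1 C2 h1 Ht.
have -> : 2 ^+ l.+1 * (2 * eta * K) + d / 2 = d.
  by rewrite /eta; move: (2 ^+ l.+1) c0 => u c0; field; nra.
by have <- := funext E.
Qed.

(** The difference of the inverses is the difference of the functions times both inverses. A lower
    bound for the modulus, valid for every sufficiently close polynomial, lets the jet bound of the
    second inverse be fixed before that polynomial is chosen. *)
Lemma reciprocal_approx Q e : (forall p, F Q p != 0) -> 0 < e ->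
  exists2 t, forall p, F (rational_mpoly t) p != 0 &
    atlas_jet (fun p => (F Q p)^-1 - (F (rational_mpoly t) p)^-1) e.
Proof.
move=> Q0 e0.
have [K K1 HK] := smooth_atlas_jet (F_smooth Q).
have FV : smooth S (fun p => (F Q p)^-1).
  exact: complex_tame_smooth (complex_tameV M_compact Q0 (complex_tame_meval f_smooth Q)).
have [V V1 HV] := smooth_atlas_jet FV.
pose N (z : R[i]) := complex.Re z ^+ 2 + complex.Im z ^+ 2.
have NV z : N z^-1 = (N z)^-1.
  case: (eqVneq (N z) 0) => [Nz|Nz].
    have z0 : z = 0.
      case: z Nz => a b; rewrite /N /= => /eqP.
      by rewrite paddr_eq0 ?sqr_ge0 // !sqrf_eq0 => /andP[/eqP -> /eqP ->].
    by rewrite z0 invr0 /N /= expr0n addr0 invr0.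
  move: Nz; case: z => a b; rewrite /N /= => Nz; field.
  by [].
have NQ p : (N (F Q p))^-1 <= 2 * V ^+ 2.
  rewrite -NV /N; have [h1 h2] := atlas_jet_point p HV.
  have sq (x : R) : `|x| <= V -> x ^+ 2 <= V ^+ 2.
    move=> h; rewrite -(real_normK (num_real x)) lerXn2r ?nnegrE //.
    exact: le_trans h.
  by rewrite mulr_natl mulr2n lerD // sq.
have V0 : 0 < V by exact: lt_le_trans V1.
have K0 : 0 < K by exact: lt_le_trans K1.
(* Chosen so that [eta * c1 <= 1] limits the loss in the squared modulus to half of its lower bound,
   the inverse of [2 * V ^+ 2]. *)
pose c1 : R := 8 * V ^+ 2 * (2 * K + 1).
have c10 : 0 < c1 by rewrite !mulr_gt0 ?exprn_gt0 // addr_gt0 // mulr_gt0.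
(* These bounds hold for any approximation within [eta <= 1]: [K + 1] for its jets, [4 * V ^+ 2] for
   the inverse of its squared modulus. *)
have [D HD] := atlas_jetV (Num.max (K + 1) (4 * V ^+ 2)).
pose D' := Num.max 1 D; have D'0 : 0 < D' by rewrite lt_max ltr01.
pose c2 : R := 2 ^+ l.+1 * (2 ^+ l.+1 * (V * D')).
have c20 : 0 < c2 by rewrite !mulr_gt0 ?exprn_gt0.
pose eta := Num.min 1 (Num.min c1^-1 (e / c2)).
have eta0 : 0 < eta by rewrite !lt_min ltr01 invr_gt0 c10 divr_gt0.
have eta1 : eta <= 1 by rewrite ge_min lexx.
have etac1 : eta * c1 <= 1 by rewrite -ler_pdivlMr // div1r !ge_min lexx !orbT.
have etac2 : eta * c2 <= e by rewrite -ler_pdivlMr // !ge_min lexx !orbT.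
have [t Ht] := rational_mpoly_dense Q eta0.
set Q' := rational_mpoly t in Ht *.
have NQ' p : (4 * V ^+ 2)^-1 <= N (F Q' p).
  have NQ0 : 0 < N (F Q p).
    have := Q0 p; rewrite /N; case: (F Q p) => a b.
    rewrite eq_complex /= => /nandP ab; rewrite lt_def addr_ge0 ?sqr_ge0 // andbT.
    by rewrite paddr_eq0 ?sqr_ge0 // !sqrf_eq0; apply/nandP.
  have := NQ p; rewrite -[X in _ <= X]invrK lef_pV2 ?posrE ?invr_gt0 ?mulr_gt0 ?exprn_gt0 //.
  have [h1 h2] := atlas_jet_point p HK; have [h3 h4] := atlas_jet_point p Ht.
  have V20 : 0 < V ^+ 2 by rewrite exprn_gt0.
  have i2 : (2 * V ^+ 2)^-1 = 2 * (4 * V ^+ 2)^-1 by field; rewrite gt_eqF.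
  have i4 : 2 * eta * (2 * K + 1) <= (4 * V ^+ 2)^-1.
    rewrite -[X in _ <= X]div1r ler_pdivlMr ?mulr_gt0 //; apply: le_trans etac1.
    by rewrite /c1 le_eqVlt; apply/orP; left; apply/eqP; ring.
  rewrite i2; move: h1 h2 h3 h4; rewrite /N.
  move: i4; set W := (4 * V ^+ 2)^-1; set L := eta.
  case: (F Q p) (F Q' p) => [a b] [a' b'] /= i4.
  rewrite !ler_norml => /andP[a1 a2] /andP[b1 b2] /andP[a3 a4] /andP[b3 b4].
  (* Factor the difference of squares; the sum of [x] and [y] is at most [2 * K + 1] in absolute
     value because [L <= 1]. *)
  have dif (x y : R) : - K <= x -> x <= K -> - L <= y - x -> y - x <= L ->
      x ^+ 2 - L * (2 * K + 1) <= y ^+ 2.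
    have L1 : L <= 1 by []. have L0 : 0 < L by [].
    move=> x1 x2 y1 y2.
    have : `|x ^+ 2 - y ^+ 2| <= L * (2 * K + 1).
      rewrite subr_sqr normrM; apply: ler_pM => //; rewrite ler_norml;
        by apply/andP; split; lra.
    by rewrite ler_norml => /andP[_]; lra.
  have := dif _ _ a1 a2 a3 a4; have := dif _ _ b1 b2 b3 b4; lra.
have V40 : 0 < 4 * V ^+ 2 by rewrite mulr_gt0 // exprn_gt0.
have Q'0 p : F Q' p != 0.
  apply/eqP => z; have := NQ' p; rewrite z /N /= expr0n addr0 => /le_lt_trans.
  by move=> /(_ (4 * V ^+ 2)^-1); rewrite invr_gt0 V40 ltxx => /(_ isT).
exists t => //.
have jQ' : atlas_jet (F Q') (Num.max (K + 1) (4 * V ^+ 2)).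
  apply: (@atlas_jet_le _ (K + eta)); first by rewrite le_max lerD2l eta1.
  have := atlas_jetD (F_smooth Q l) (ClB (F_smooth Q' l) (F_smooth Q l)) HK Ht.
  by under [X in atlas_jet X _]eq_fun do rewrite addrC subrK.
have jV : atlas_jet (fun p => (F Q' p)^-1) D'.
  apply: (@atlas_jet_le _ D); first by rewrite le_max lexx orbT.
  apply: HD => // [|p]; first exact: F_smooth.
  have Np : 0 < N (F Q' p) by apply: lt_le_trans (NQ' p); rewrite invr_gt0.
  rewrite le_max; apply/orP; right; rewrite -[X in _ <= X]invrK lef_pV2 ?posrE ?invr_gt0 //.
  exact: NQ'.
have F'V : smooth S (fun p => (F Q' p)^-1).
  exact: complex_tame_smooth (complex_tameV M_compact Q'0 (complex_tame_meval f_smooth Q')).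
have j1 := atlas_jetM (FV l) (F'V l) HV jV.
have j2 := atlas_jetM (ClB (F_smooth Q' l) (F_smooth Q l)) (ClM (FV l) (F'V l)) Ht j1.
apply: (@atlas_jet_le _ (2 ^+ l.+1 * (eta * (2 ^+ l.+1 * (V * D'))))).
  by rewrite mulrCA.
have <- : (fun p => (F Q' p - F Q p) * ((F Q p)^-1 * (F Q' p)^-1)) =
    (fun p => (F Q p)^-1 - (F Q' p)^-1).
  apply/funext => p; have := Q0 p; have := Q'0 p; rewrite -/(F Q p).
  by move: (F Q p) (F Q' p) => y z z0 y0; field; rewrite z0 y0.
exact: j2.
Qed.

End RationalCoefficients.

End AtlasJet.

(** * Recurring denominators and the final approximation *)

(** Decode each index as a pair and keep the second component: the free first component makes every
    [t] recur. The element [t0] fills the indices that decode to nothing or to an element outside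
    [P]. *)
Lemma infinitely_repeating_enumeration (T : countType) (P : T -> Prop) (t0 : T) :
  P t0 -> exists u : nat -> T, (forall j, P (u j)) /\
    forall t, P t -> forall N, exists2 j, (N <= j)%N & u j = t.
Proof.
move=> P0; pose u j := if (unpickle j : option (nat * T)) is Some kt then
  if `[< P kt.2 >] then kt.2 else t0 else t0.
exists u; split=> [j|t Pt N].
  by rewrite /u; case: (unpickle j) => // kt; case: ifPn => // /asboolP.
have [|k Nk] := @injective_unbounded (fun k => pickle (k, t)) _ N.
  by move=> k k' /(pcan_inj pickleK) [].
by exists (pickle (k, t)) => //; rewrite /u pickleK /= asboolT.
Qed.

Theorem corollary1p3 (R : realType) (k m n : nat)
    (k_gt0 : (0 < k)%N) (m_gt0 : (0 < m)%N) (n_gt0 : (0 < n)%N)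
    (M : topologicalType) (S : smooth_structure R M m)
    (M_compact : compact [set: M]) (M_hausdorff : hausdorff_space M)
    (r : nat) (B : 'I_r -> chart R M m) (B_atlas : finite_atlas S B)
    (l : nat) (l_le_k : (l <= k)%N) (f : 'I_n -> M -> R[i]) :
  RD_basis S B l f ->
  exists g : M -> R[i], smooth S g /\ PD_basis S B l (family_rcons f g).
Proof.
move=> [f_smooth f_dense].
pose F Q p := meval (f ^~ p) Q.
have F_smooth Q : smooth S (F Q).
  exact: complex_tame_smooth (complex_tame_meval f_smooth Q).
pose admissible t := forall p, F (rational_mpoly R t) p != 0.
(* The constant polynomial 1 serves as the filler element of the enumeration. *)
have adm1 : admissible [:: (mnm0, (1, 0))].
  move=> p; rewrite /F /rational_mpoly big_seq1 mevalM mevalC /= mpolyX0 meval1 mulr1.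
  by rewrite rmorph1 eq_complex /= oner_eq0.
have [u [u_adm u_rep]] := infinitely_repeating_enumeration adm1.
have [g [g_smooth g_approx]] :=
  reciprocals_generator M_compact f_smooth (q := fun j => rational_mpoly R (u j)) u_adm.
exists g; split => //.
have fam_smooth i : smooth S (family_rcons f g i).
  by rewrite /family_rcons; case: unliftP => [j|] _ /=.
split => // h Ch e e0.
have [_ [P [Q [Q0 ->]]] hPQ] := f_dense h Ch (e / 2) (divr_gt0 e0 (ltr0Sn _ 1)).
have poly_smooth A : polynomial_in (family_rcons f g) A -> smooth S A.
  by move=> [Z ->]; exact: complex_tame_smooth (complex_tame_meval fam_smooth Z).
have QV : smooth S (fun p => (F Q p)^-1).
  exact: complex_tame_smooth (complex_tameV M_compact Q0 (complex_tame_meval f_smooth Q)).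
have [K K1 HK] := smooth_atlas_jet M_compact l B_atlas (F_smooth P).
have K0 : 0 < K by exact: lt_le_trans K1.
have [C HC] := atlas_jets_le B_atlas M_compact l f_smooth.
(* With this constant a jet bound [eps + eps] on the error of the inverse becomes a norm of at most
   [(c - 1) * (eps / 2)] after multiplication by [F P]. The summand 1 keeps [c] positive even if [r]
   is 0. *)
pose c : R := r%:R * #|{: bmultinom m l.+1}|%:R * 2 ^+ l.+1 * K * 4 * 2 + 1.
have c0 : 0 < c by rewrite ltr_wpDl // !mulr_ge0 // ?exprn_ge0 // ltW.
pose eps := e / c.
have eps0 : 0 < eps by rewrite divr_gt0.
have [t t_adm Ht] := reciprocal_approx M_compact l B_atlas f_smooth Q0 eps0.
have [N HN] := g_approx l C eps eps0.
(* The threshold [N] is known before the index: recurrence supplies an occurrence of [t] beyond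
   it. *)
have [j Nj uj] := u_rep t t_adm N.
have [A polyA HA] := HN j Nj.
have jA : atlas_jet B l (fun p => (F (rational_mpoly R t) p)^-1 - A p) eps.
  move=> b x Bx; have [BS _ _] := B_atlas.
  by have := HA _ _ (BS b) Bx (HC b x Bx); rewrite uj.
have A_smooth := poly_smooth A polyA.
have TV : smooth S (fun p => (F (rational_mpoly R t) p)^-1).
  exact: complex_tame_smooth (complex_tameV M_compact t_adm (complex_tame_meval f_smooth _)).
have j1 := atlas_jetD B_atlas (ClB (QV l) (TV l)) (ClB (TV l) (A_smooth l)) Ht jA.
have j2 := atlas_jetM B_atlas (F_smooth P l)
  (ClD (ClB (QV l) (TV l)) (ClB (TV l) (A_smooth l))) HK j1.
have PA : polynomial_in (family_rcons f g) (fun p => F P p * A p).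
  by apply: polynomial_inM => //; exact: polynomial_in_adjoin.
exists (fun p => F P p * A p) => //.
pose h1 p := h p - F P p / F Q p.
(* The error beyond [h1], which density keeps below [e / 2]: first the denominator is made rational,
   then its inverse is replaced by the polynomial [A] in the enlarged family. *)
pose h2 p := F P p * ((F Q p)^-1 - (F (rational_mpoly R t) p)^-1 +
  ((F (rational_mpoly R t) p)^-1 - A p)).
have -> : (fun p => h p - F P p * A p) = (fun p => h1 p + h2 p).
  by apply/funext => p; rewrite /h1 /h2; ring.
have Ch1 : Cl S l h1 by apply: ClB => //; apply: ClM; [exact: F_smooth|exact: QV].
have Ch2 : Cl S l h2.
  by apply: ClM; [exact: F_smooth|exact: ClD (ClB (QV l) (TV l)) (ClB (TV l) (A_smooth l))].
apply: (le_lt_trans (Cl_normD B_atlas Ch1 Ch2)).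
have -> : e%:E = ((e / 2)%:E + (e / 2)%:E)%E by rewrite -EFinD; congr (_%:E); field.
apply: (@le_lt_trans _ _ (Cl_norm B l h1 + (e / 2)%:E)%E); last by rewrite lteD2rE.
apply: leeD => //.
have j3 : atlas_jet B l h2 (2 ^+ l.+1 * (K * (eps + eps))) by exact: j2.
apply: le_trans (Cl_norm_le _ j3) _.
  by rewrite !mulr_ge0 ?exprn_ge0 ?addr_ge0 // ltW.
rewrite lee_fin.
have -> : r%:R * (#|{: bmultinom m l.+1}|%:R * (2 ^+ l.+1 * (K * (eps + eps)) +
    2 ^+ l.+1 * (K * (eps + eps)))) = (c - 1) * (eps / 2).
  by rewrite /c; field.
have -> : e / 2 = c * (eps / 2) by rewrite /eps; field; rewrite gt_eqF.
apply: ler_wpM2r; first by rewrite divr_ge0 // ltW.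
by rewrite lerBlDr lerDl ler01.
Qed.
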